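(* For each $\alpha\in\{\min,\max\}$, the norm $\|\cdot\|_\alpha$ is not uniformly definable across all $\mathrm{C}^*$-algebras. That is, letting $T$ be the theory of all $\mathrm{C}^*$-algebras, it is not the case that for every $n\geq 1$ the $T$-function $P^{\alpha}_n$, given by $P^{\alpha}_{A,n}(\vec a,\vec b):=\left\|\sum_{k=1}^n a_k\otimes b_k\right\|_{A\otimes_\alpha A}$ for $A\models T$ and $\vec a,\vec b\in A_1^n$, is realized.
   Context: $A\odot B$ denotes the algebraic tensor product of $\mathrm{C}^*$-algebras; $\|\cdot\|_{\min}$ and $\|\cdot\|_{\max}$ are the minimal (spatial) and maximal $\mathrm{C}^*$-norms on it, with completions $A\otimes_{\min}B$ and $A\otimes_{\max}B$. $A_1$ denotes the operator norm unit ball of $A$. Formulae in the language of $\mathrm{C}^*$-algebras are built from the atomic formulae $\|p(\vec x)\|$, $p$ a $*$-polynomial (variables ranging over the operator norm unit ball), by closing under continuous combinations $u(\varphi_1,\ldots,\varphi_m)$ ($u:\mathbb{R}^m\to\mathbb{R}$ continuous) and the quantifiers $\sup_x,\inf_x$ (over the unit ball). For a theory $T$ extending the theory of $\mathrm{C}^*$-algebras, formulae in variables $x_1,\dots,x_n$ carry the pseudometric $d_T(\varphi_1,\varphi_2):=\sup\{|\varphi_1(\vec a)^A-\varphi_2(\vec a)^A| : A\models T,\ \vec a\in A_1^n\}$. Elements of the separation-completion are called $T$-formulae; each $T$-formula $\varphi$ has an interpretation $\varphi^A:A_1^n\to\mathbb{R}$ for every $A\models T$. A $T$-function $P$ is an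 assignment $A\mapsto P^A$ of a bounded real-valued predicate $P^A$ on $A_1^n$ (with bound independent of $A$) to each model $A$ of $T$; it is realized if there is a $T$-formula $\varphi$ with $P^A=\varphi^A$ for all $A\models T$. *)

(* Defs.v *)
From HB Require Import structures.
From mathcomp Require Import all_boot all_order all_algebra sesquilinear.
From mathcomp Require Import complex.
From mathcomp Require Import all_classical all_reals all_analysis.

Set Implicit Arguments.
Unset Strict Implicit.
Unset Printing Implicit Defensive.

Import Order.TTheory GRing.Theory Num.Theory.
Import numFieldNormedType.Exports.

Local Open Scope classical_set_scope.
Local Open Scope ring_scope.

(* The norm of a normed space over R[i] is R[i]-valued; [rnorm] is the same
   norm seen as a real number. *)
Definition rnorm (R : realType) (V : normedModType R[i]) (x : V) : R :=
  complex.Re `|x|.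

(* The closed unit ball V_1. *)
Definition unit_ball (R : realType) (V : normedModType R[i]) : set V :=
  [set x | `|x| <= 1].

(* C*-algebras are complex and are not assumed to be unital. *)
Record cstarAlg (R : realType) : Type := CStarAlg {
  cstar_sort :> completeNormedModType R[i];
  cmul : {bilinear cstar_sort -> cstar_sort -> cstar_sort};
  cstar : cstar_sort -> cstar_sort;
  cmulA : forall a b c, cmul a (cmul b c) = cmul (cmul a b) c;
  cstarD : forall a b, cstar (a + b) = cstar a + cstar b;
  cstarZ : forall (z : R[i]) a, cstar (z *: a) = Num.conj z *: cstar a;
  cstarK : forall a, cstar (cstar a) = a;
  cstarM : forall a b, cstar (cmul a b) = cmul (cstar b) (cstar a);
  cnormM : forall a b, `|cmul a b| <= `|a| * `|b|;
  cnorm_cstar : forall a, `|cmul (cstar a) a| = `|a| ^+ 2 }.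

Arguments cmul {R A} : rename.
Arguments cstar {R A} : rename.

(* The inner product is linear in its first argument. *)
Record hilbert (R : realType) : Type := Hilbert {
  hilbert_sort :> completeNormedModType R[i];
  inner : {dot hilbert_sort for @Num.conj R[i]};
  inner_norm : forall h, inner h h = `|h| ^+ 2 }.

Definition opnorm (R : realType) (H : hilbert R) (X : H -> H) : R :=
  sup [set rnorm (X h) | h in @unit_ball R H].

Record rep (R : realType) (A : cstarAlg R) (H : hilbert R) : Type := Rep {
  rep_op :> A -> {linear H -> H};
  rep_bounded : forall a, continuous (rep_op a);
  rep_linear : forall h, linear (fun a => rep_op a h);
  repM : forall a b h, rep_op (cmul a b) h = rep_op a (rep_op b h);
  rep_adj : forall a h k,
    inner H (rep_op a h) k = inner H h (rep_op (cstar a) k) }.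

(* A *-representation of the *-algebra A \odot B on H.  By the universal
   property of A \odot B it is a bilinear map (a, b) |-> theta(a \otimes b) into
   the bounded operators on H compatible with
     (a \otimes b)(a' \otimes b') = aa' \otimes bb' and
     (a \otimes b)^* = a^* \otimes b^*. *)
Record tensor_rep (R : realType) (A B : cstarAlg R) (H : hilbert R) : Type :=
  TensorRep {
  trep_op :> A -> B -> {linear H -> H};
  trep_bounded : forall a b, continuous (trep_op a b);
  trep_linearl : forall b h, linear (fun a => trep_op a b h);
  trep_linearr : forall a h, linear (fun b => trep_op a b h);
  trepM : forall a b a' b' h,
    trep_op (cmul a a') (cmul b b') h = trep_op a b (trep_op a' b' h);
  trep_adj : forall a b h k,
    inner H (trep_op a b h) k = inner H h (trep_op (cstar a) (cstar b) k) }.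

(* tau exhibits L as the Hilbert space tensor product of H and K, i.e. as the
   completion of H \odot K for the product inner product. *)
Definition is_hilbert_tensor (R : realType) (H K L : hilbert R)
    (tau : {bilinear H -> K -> L}) : Prop :=
  (forall h k h' k',
     inner L (tau h k) (tau h' k') = inner H h h' * inner K k k') /\
  dense [set x : L | exists (m : nat) (h : 'I_m -> H) (k : 'I_m -> K),
                       x = \sum_(i < m) tau (h i) (k i)].

(* theta = pi \otimes sigma for representations pi of A on H and sigma of B on
   K, acting on the Hilbert space tensor product L of H and K. *)
Definition is_spatial (R : realType) (A B : cstarAlg R) (L : hilbert R)
    (theta : tensor_rep A B L) : Prop :=
  exists (H K : hilbert R) (tau : {bilinear H -> K -> L})
         (pi : rep A H) (sigma : rep B K),
    is_hilbert_tensor tau /\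
    forall a b h k, theta a b (tau h k) = tau (pi a h) (sigma b k).

Inductive tensor_kind := TensorMin | TensorMax.

Definition admissible (R : realType) (alpha : tensor_kind) (A B : cstarAlg R)
    (L : hilbert R) (theta : tensor_rep A B L) : Prop :=
  match alpha with
  | TensorMin => is_spatial theta
  | TensorMax => True
  end.

(* The norm of sum_k a_k \otimes b_k in A \otimes_alpha B: the supremum of
   ||theta(sum_k a_k \otimes b_k)|| over the representations pi \otimes sigma
   for the minimal (spatial) norm, and over all representations of A \odot B
   for the maximal norm. *)
Definition tensor_norm (R : realType) (alpha : tensor_kind) (A B : cstarAlg R)
    (n : nat) (a : 'I_n -> A) (b : 'I_n -> B) : R :=
  sup [set r | exists (L : hilbert R) (theta : tensor_rep A B L),
        admissible alpha theta /\
        r = opnorm (fun x : L => \sum_(k < n) theta (a k) (b k) x)].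

(* Complex *-polynomials without constant term, in n noncommuting variables. *)
Inductive starpoly (R : realType) (n : nat) : Type :=
  | SPzero
  | SPvar of 'I_n
  | SPadd of starpoly R n & starpoly R n
  | SPscale of R[i] & starpoly R n
  | SPmul of starpoly R n & starpoly R n
  | SPstar of starpoly R n.

Fixpoint peval (R : realType) (A : cstarAlg R) (n : nat) (v : 'I_n -> A)
    (p : starpoly R n) : A :=
  match p with
  | SPzero => 0
  | SPvar i => v i
  | SPadd p q => peval v p + peval v q
  | SPscale z p => z *: peval v p
  | SPmul p q => cmul (peval v p) (peval v q)
  | SPstar p => cstar (peval v p)
  end.

(* Formulae with free variables indexed by 'I_n; a quantifier binds the
   variable ord_max of 'I_n.+1. *)
Inductive formula (R : realType) : nat -> Type :=
  | Fnorm n of starpoly R n : formula R n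
  | Fconn n m (u : 'rV[R]_m -> R) of continuous u & ('I_m -> formula R n) :
      formula R n
  | Fsup n of formula R n.+1 : formula R n
  | Finf n of formula R n.+1 : formula R n.

Definition extend (T : Type) (n : nat) (v : 'I_n -> T) (a : T) (i : 'I_n.+1) :
    T :=
  oapp v a (unlift ord_max i).

Fixpoint interp (R : realType) (A : cstarAlg R) (n : nat) (phi : formula R n) :
    ('I_n -> A) -> R :=
  match phi in formula _ n return ('I_n -> A) -> R with
  | Fnorm _ p => fun v => rnorm (peval v p)
  | Fconn _ _ u _ psi => fun v => u (\row_i interp (psi i) v)
  | Fsup _ psi => fun v =>
      sup [set interp psi (extend v a) | a in @unit_ball R A]
  | Finf _ psi => fun v =>
      inf [set interp psi (extend v a) | a in @unit_ball R A]
  end.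

Definition in_ball (R : realType) (A : cstarAlg R) (n : nat) (v : 'I_n -> A) :
    Prop :=
  forall i, unit_ball (v i).

(* A theory extending the theory of C*-algebras is given by a set of sentences;
   its models are the C*-algebras in which these sentences take the value 0. *)
Definition theory (R : realType) := set (formula R 0).

Definition models (R : realType) (T : theory R) (A : cstarAlg R) : Prop :=
  forall sigma, T sigma -> forall v : 'I_0 -> A, interp sigma v = 0.

Definition cstar_theory (R : realType) : theory R :=
  [set sigma | forall (A : cstarAlg R) (v : 'I_0 -> A), interp sigma v = 0].

Arguments cstar_theory R : clear implicits.

Definition dT (R : realType) (T : theory R) (n : nat) (phi psi : formula R n) :
    R :=
  sup [set r | exists (A : cstarAlg R) (v : 'I_n -> A),
        [/\ models T A, in_ball v & r = `|interp phi v - interp psi v|]].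

(* An element of the separation-completion of the space of formulae for dT,
   represented by a dT-Cauchy sequence.  Sequences representing the same element
   have the same interpretation, so no quotient is taken. *)
Record Tformula (R : realType) (T : theory R) (n : nat) : Type := TFormula {
  tf_seq : nat -> formula R n;
  tf_cauchy : forall e : R, 0 < e -> exists N : nat,
    forall i j : nat, (N <= i)%N -> (N <= j)%N ->
      dT T (tf_seq i) (tf_seq j) < e }.

Definition tinterp (R : realType) (T : theory R) (n : nat) (phi : Tformula T n)
    (A : cstarAlg R) (v : 'I_n -> A) : R :=
  lim (interp (tf_seq phi k) v @[k --> \oo]).

(* Only the values of P on tuples from the unit balls of models of T matter. *)
Definition realized (R : realType) (T : theory R) (n : nat)
    (P : forall A : cstarAlg R, ('I_n -> A) -> R) : Prop :=
  exists phi : Tformula T n,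
    forall A : cstarAlg R, models T A ->
    forall v : 'I_n -> A, in_ball v -> P A v = tinterp phi v.

(* P^alpha_n, in 2n variables: the first n are the a_k, the last n the b_k. *)
Definition tensor_fun (R : realType) (alpha : tensor_kind) (n : nat)
    (A : cstarAlg R) (v : 'I_(n + n) -> A) : R :=
  tensor_norm alpha (fun k => v (lshift n k)) (fun k => v (rshift n k)).

Arguments tensor_fun {R} alpha n A v.

(* Main.v *)
Require Import Defs.
From HB Require Import structures.
From mathcomp Require Import all_boot all_order all_algebra sesquilinear.
From mathcomp Require Import complex.
From mathcomp Require Import all_classical all_reals all_analysis.
From mathcomp Require Import zify lra ring.

Set Implicit Arguments.
Unset Strict Implicit.
Unset Printing Implicit Defensive.

Import Order.TTheory GRing.Theory Num.Theory.
Import numFieldNormedType.Exports.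

Local Open Scope classical_set_scope.
Local Open Scope ring_scope.
Local Notation "x %:C" := (real_complex _ x) : ring_scope.

(** Fix primes p and q and let the shears S (v1, v2) = (v1 + v2, v2) and
    T (v1, v2) = (v1, v1 + v2) act on the torus (Z/p)^2 as permutation matrices
    of l2((Z/p)^2); cut the torus without its origin into 3 x 3 boxes and take
    also the nine diagonal projections onto them.  These eleven contractions
    [gen p] are the tuple that defeats definability.  Put [gen p] in the first
    summand of M_p (+) M_q and [gen q] in the second, and form the tensor
    sum_l gen_p(l) (x) gen_q(l).

    If p = q, the vector sum_v e_v (x) e_v, over v different from the origin, is
    fixed by S (x) S, by T (x) T and by the sum of the nine box projections, so
    both tensor norms are at least 3 ([pair_norm_diag]).  If p and q are
    distinct, both are at most 3 - 1/100 ([pair_norm_coprime]).  Indeed a vector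
    whose image has norm close to 3 times its own would be almost fixed by the
    three operators, hence almost supported on the pairs (v, w) lying in the
    same box.  There the difference v/p - w/q is less than 1/3 in each
    coordinate, so the shears act on it linearly, without wrapping around, and
    it never vanishes, p and q being coprime.  But a mass on the plane without
    the origin cannot be almost invariant under both shears: they map the double
    quadrant xy >= 0, one axis removed, into disjoint parts of itself, and their
    inverses do so for the rest ([paradoxical_gap], [pair_gap]).  This is the
    standard argument for the relative property (T) of Z^2 in its semidirect
    product with SL_2(Z).  Every representation of M_p (.) M_q reduces to this
    statement about functions, through the norms of the components of a vector
    ([tensor_op_bound]).  In the code a torus is indexed by its modulus minus
    one.

    A formula, however, cannot see whether p = q.  As in the Feferman-Vaught
    analysis of products, its value on a direct sum B (+) C, at a tuple with
    components v in B and w in C, depends up to any given error only on one of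
    finitely many colours of (B, v), and on (C, w) ([finite_colouring]).  If the
    tensor norm were realized the same would hold for it
    ([realized_colouring]); by the pigeonhole principle two distinct primes
    p and q give tuples of the same colour, and exchanging M_p for M_q in
    M_p (+) M_q would change the norm by less than the gap. *)

(** * Norms on C^I *)

Section ComplexNorm.
Variable R : realType.
Local Notation C := (R[i]).

Lemma rnormE (V : normedModType C) (x : V) : `|x| = (rnorm x)%:C.
Proof. by rewrite /rnorm RRe_real ?ger0_real. Qed.

Lemma rnorm_ge0 (V : normedModType C) (x : V) : 0 <= rnorm x.
Proof. by rewrite -lecR -rnormE normr_ge0. Qed.

Lemma unit_ballE (V : normedModType C) (x : V) :
  unit_ball x <-> rnorm x <= 1.
Proof. by rewrite /unit_ball /= rnormE -[1]/(1%:C) lecR. Qed.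

Lemma normc_ge_Im (z : C) : `|complex.Im z|%:C <= `|z|.
Proof.
case: z => a b; rewrite normc_def lecR /= -sqrtr_sqr ler_wsqrtr//.
by rewrite lerDr sqr_ge0.
Qed.

Lemma normc_le_ReIm (z : C) : `|z| <= (`|complex.Re z| + `|complex.Im z|)%:C.
Proof.
rewrite [z in leLHS]complexE (le_trans (ler_normD _ _))// normrM.
have nr (x : R) : `|x%:C| = `|x|%:C.
  by rewrite normc_def /= expr0n /= addr0 sqrtr_sqr.
have -> : `|'i%C| = 1 :> C by rewrite normc_def /= expr0n expr1n add0r sqrtr1.
by rewrite mul1r !nr rmorphD.
Qed.

End ComplexNorm.

(** Domination of the coordinates makes [C^I] complete.  Both the Hilbert norm
    and the operator norm on matrices are of this kind. *)
Record coord_norm (R : realType) (I : finType) := CoordNorm {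
  cn_norm :> {ffun I -> R[i]} -> R[i];
  cn_normD : forall x y, cn_norm (x + y) <= cn_norm x + cn_norm y;
  cn_normZ : forall (l : R[i]) x, cn_norm (l *: x) = `|l| * cn_norm x;
  cn_coord : forall (x : {ffun I -> R[i]}) i, `|x i| <= cn_norm x }.

Definition cspace (R : realType) (I : finType) (N : coord_norm R I) : Type :=
  {ffun I -> R[i]}.

Section CoordSpace.
Variables (R : realType) (I : finType) (N : coord_norm R I).
Local Notation C := (R[i]).
Local Notation V := (cspace N).

HB.instance Definition _ := GRing.Lmodule.on V.

Let N_eq0 (x : V) : N x = 0 -> x = 0.
Proof.
move=> Nx; apply/ffunP => i; rewrite ffunE.
by apply/eqP; rewrite -normr_le0 -Nx cn_coord.
Qed.

HB.instance Definition _ :=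
  @Lmodule_isNormed.Build C V N (@cn_normD _ _ N) (@cn_normZ _ _ N) N_eq0.

Lemma cspace_normE (x : V) : `|x| = N x. Proof. by []. Qed.

Definition single (i : I) : V := [ffun j => (j == i)%:R].

Lemma cspaceE (x : V) : x = \sum_i x i *: single i.
Proof.
apply/ffunP => j; rewrite sum_ffunE (bigD1 j) //= big1 => [|i ij].
  by rewrite !ffunE eqxx addr0 /GRing.scale /= mulr1.
by rewrite !ffunE eq_sym (negbTE ij) /GRing.scale /= mulr0.
Qed.

Lemma cspace_norm_le (x : V) : `|x| <= \sum_i `|x i| * `|single i|.
Proof.
rewrite {1}(cspaceE x) (le_trans (ler_norm_sum _ _ _))//.
by apply: ler_sum => i _; rewrite normrZ.
Qed.

(** Real and imaginary parts of the coordinates are Lipschitz, so they converge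
    along a Cauchy filter; the norm is bounded by a multiple of their sum. *)
Lemma cspace_complete (F : set_system V) : ProperFilter F -> cauchy F -> cvg F.
Proof.
move=> FF /cauchy_ballP Fc.
have part (g : V -> R) : (forall x y, `|g x - g y|%:C <= `|x - y|) ->
    cvg (g @ F).
  move=> gL; apply: cauchy_cvg; apply/cauchy_ballP => e e0.
  have e0C : 0 < e%:C :> C by rewrite ltcR.
  have H := Fc _ e0C; rewrite near_map2.
  apply: filterS H => -[x y] /=; rewrite -!ball_normE /= => xy.
  by rewrite -ltcR; apply: le_lt_trans xy; exact: gL.
have [|a Fa] := @choice I R (fun i a => (fun x : V => complex.Re (x i)) @ F --> a).
  move=> i; apply/cvg_ex/part => x y.
  rewrite -raddfB (le_trans (normc_ge_Re _))//.
  by have := cn_coord N (x - y) i; rewrite !ffunE.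
have [|b Fb] := @choice I R (fun i b => (fun x : V => complex.Im (x i)) @ F --> b).
  move=> i; apply/cvg_ex/part => x y.
  rewrite -raddfB (le_trans (normc_ge_Im _))//.
  by have := cn_coord N (x - y) i; rewrite !ffunE.
pose l : V := [ffun i => (a i +i* b i)%C].
apply/cvg_ex; exists l; apply/cvgrPdist_lt => e e0.
pose s : R := \sum_i 2 * rnorm (single i) + 1.
have s0 : 0 < s.
  by rewrite ltr_wpDl// sumr_ge0// => i _; rewrite mulr_ge0 ?rnorm_ge0.
have eE : e = (complex.Re e)%:C by rewrite RRe_real ?gtr0_real.
have e0R : 0 < complex.Re e by rewrite -ltcR -eE.
pose d := complex.Re e / s.
have d0 : 0 < d by rewrite divr_gt0.
have /= Ha : \forall x \near F, forall i : I, `|a i - complex.Re ((x : V) i)| < d.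
  by apply: filter_forall => i; move/cvgrPdist_lt : (Fa i) => /(_ _ d0).
have /= Hb : \forall x \near F, forall i : I, `|b i - complex.Im ((x : V) i)| < d.
  by apply: filter_forall => i; move/cvgrPdist_lt : (Fb i) => /(_ _ d0).
apply: filterS2 Ha Hb => x Ha Hb.
rewrite (le_lt_trans (cspace_norm_le _))//.
apply: (@le_lt_trans _ _ (\sum_i (d * (2 * rnorm (single i)))%:C)).
  apply: ler_sum => i _; rewrite mulrA rmorphM /= -rnormE ler_wpM2r//.
  rewrite (le_trans (normc_le_ReIm _))// lecR !ffunE !raddfB /= mulr_natr mulr2n.
  by rewrite lerD// ltW.
rewrite -rmorph_sum/= eE ltcR -mulr_sumr /d -mulrA gtr_pMr//.
by rewrite mulrC ltr_pdivrMr// mul1r ltrDl.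
Qed.

HB.instance Definition _ := Uniform_isComplete.Build V cspace_complete.

End CoordSpace.

(** * The Hilbert space l2(I) *)

Section L2.
Variables (R : realType) (I : finType).
Local Notation C := (R[i]).
Local Notation F := {ffun I -> C^o}.

Definition l2_inner (u v : F) : C := \sum_i u i * Num.conj (v i).

Lemma l2_inner_bilinear :
  bilinear_for ( *%R : C -> C -> C) (@Num.conj C \; *%R) l2_inner.
Proof.
split=> [v a u u'|u a v v'] /=.
  rewrite /l2_inner /= mulr_sumr -big_split; apply: eq_bigr => i _ /=.
  by rewrite !ffunE mulrDl mulrA.
rewrite /l2_inner /= mulr_sumr -big_split; apply: eq_bigr => i _ /=.
by rewrite !ffunE rmorphD rmorphM mulrDr mulrCA.
Qed.

HB.instance Definition _ := bilinear_isBilinear.Build C F F C _ _ l2_inner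
  l2_inner_bilinear.

Lemma l2_inner_hermitian (u v : F) :
  l2_inner u v = (-1) ^+ false * Num.conj (l2_inner v u).
Proof.
rewrite mul1r rmorph_sum; apply: eq_bigr => i _.
by rewrite rmorphM /= conjCK mulrC.
Qed.

HB.instance Definition _ := isHermitianSesquilinear.Build C F false
  Num.conj l2_inner l2_inner_hermitian.

Lemma l2_innerE (u : F) : l2_inner u u = \sum_i `|u i| ^+ 2.
Proof. by apply: eq_bigr => i _; rewrite normCK. Qed.

Lemma l2_inner_gt0 (u : F) : u != 0 -> 0 < l2_inner u u.
Proof.
move=> u0; rewrite l2_innerE lt_def sumr_ge0 ?andbT => [|i _]; last first.
  by rewrite exprn_ge0.
apply: contra u0 => /eqP/psumr_eq0P H; apply/eqP/ffunP => i; rewrite ffunE.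
apply/eqP; rewrite -normr_eq0 -sqrf_eq0 H// => j _.
Qed.

HB.instance Definition _ := isDotProduct.Build C F l2_inner l2_inner_gt0.

Definition l2_norm (u : {ffun I -> C}) : C := sqrtC (l2_inner u u).

Lemma l2_normD (u v : {ffun I -> C}) : l2_norm (u + v) <= l2_norm u + l2_norm v.
Proof. exact: (triangle_lerif l2_inner (u : F) (v : F)). Qed.

Lemma l2_normZ (a : C) (u : {ffun I -> C}) : l2_norm (a *: u) = `|a| * l2_norm u.
Proof.
rewrite /l2_norm.
have -> := @dnormZ C F l2_inner a u.
by rewrite rootCMl ?exprn_ge0// sqrCK.
Qed.

Lemma l2_norm_coord (u : {ffun I -> C}) i : `|u i| <= l2_norm u.
Proof.
rewrite -[leLHS]sqrCK// ler_sqrtC ?nnegrE ?exprn_ge0 ?dnorm_ge0//.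
by rewrite l2_innerE (bigD1 i) //= lerDl sumr_ge0// => j _; rewrite exprn_ge0.
Qed.

Definition l2 : coord_norm R I := CoordNorm l2_normD l2_normZ l2_norm_coord.

Lemma l2_inner_norm (h : cspace l2) : l2_inner h h = `|h| ^+ 2.
Proof. by rewrite cspace_normE /= /l2_norm sqrtCK. Qed.

Definition l2_hilbert : hilbert R :=
  @Hilbert R (cspace l2) (l2_inner : {dot cspace l2 for @Num.conj C}) l2_inner_norm.

End L2.

(** * The C*-algebra of matrices indexed by I *)

Section MatrixAlgebra.
Variables (R : realType) (I : finType).
Local Notation C := (R[i]).
Local Notation H := (cspace (l2 R I)).
Local Notation M := {ffun I * I -> C}.

Definition mact (a : M) (h : H) : H := [ffun x => \sum_y a (x, y) * h y].

Lemma mact_linear a : linear (mact a).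
Proof.
move=> z h k; apply/ffunP => x; rewrite !ffunE /GRing.scale /= mulr_sumr.
by rewrite -big_split; apply: eq_bigr => y _ /=; rewrite !ffunE mulrDr mulrCA.
Qed.

HB.instance Definition _ a :=
  GRing.isLinear.Build C H H *:%R (mact a) (mact_linear a).

Lemma mact_linearl h : linear (fun a => mact a h).
Proof.
move=> z a b; apply/ffunP => x; rewrite !ffunE /GRing.scale /= mulr_sumr.
by rewrite -big_split; apply: eq_bigr => y _ /=; rewrite !ffunE mulrDl mulrA.
Qed.

Lemma mact_bound a : exists K : R, forall h, `|mact a h| <= K%:C * `|h|.
Proof.
pose K : C := \sum_x (\sum_y `|a (x, y)|) * `|single (l2 R I) x|.
have K0 : 0 <= K.
  by apply: sumr_ge0 => x _; rewrite mulr_ge0// sumr_ge0.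
exists (complex.Re K) => h; rewrite RRe_real ?ger0_real//.
rewrite (le_trans (cspace_norm_le _))// mulr_suml ler_sum// => x _.
rewrite mulrAC ler_wpM2r// ffunE (le_trans (ler_norm_sum _ _ _))//.
rewrite mulr_suml ler_sum// => y _; rewrite normrM ler_wpM2l//.
exact: (cn_coord (l2 R I) h y).
Qed.

(** The operator norm on l2(I). *)
Definition mnorm (a : M) : R :=
  sup [set rnorm (mact a h) | h in @unit_ball R H].

Lemma mnorm_has_sup a : has_sup [set rnorm (mact a h) | h in @unit_ball R H].
Proof.
split; first by exists (rnorm (mact a 0)), 0 => //; rewrite /unit_ball /= normr0.
have [K HK] := mact_bound a; exists (`|K|) => _ [h /unit_ballE h1 <-].
rewrite -lecR -rnormE (le_trans (HK h))// rnormE -rmorphM lecR.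
rewrite (le_trans (ler_norm _))// normrM ler_piMr// ger0_norm//.
exact: rnorm_ge0.
Qed.

Lemma mnormP a h : `|mact a h| <= (mnorm a)%:C * `|h|.
Proof.
have [->|h0] := eqVneq h 0; first by rewrite linear0 !normr0 mulr0.
have h0' : 0 < `|h| by rewrite normr_gt0.
rewrite -ler_pdivrMr// mulrC -[X in X * _]ger0_norm ?invr_ge0 ?(ltW h0')// -normrZ.
rewrite -linearZ rnormE lecR; apply: sup_upper_bound (mnorm_has_sup a) _ _.
exists (`|h|^-1 *: h) => //; rewrite /unit_ball /= normrZ ger0_norm.
  by rewrite mulVf ?gt_eqF.
by rewrite invr_ge0 ltW.
Qed.

Lemma mnorm_le a (c : R) : 0 <= c -> (forall h, `|mact a h| <= c%:C * `|h|) ->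
  mnorm a <= c.
Proof.
move=> c0 Hc; apply: ge_sup; first by case: (mnorm_has_sup a).
move=> _ [h /unit_ballE h1 <-]; rewrite -lecR -rnormE (le_trans (Hc h))//.
by rewrite rnormE -rmorphM lecR ler_piMr.
Qed.

Lemma mnorm_ge0 a : 0 <= mnorm a.
Proof.
apply: (@le_trans _ _ (rnorm (mact a 0))); first exact: rnorm_ge0.
apply: (sup_upper_bound (mnorm_has_sup a)).
by exists 0 => //; rewrite /unit_ball /= normr0.
Qed.

Definition mnormC (a : M) : C := (mnorm a)%:C.

Lemma mnormC_ge0 a : 0 <= mnormC a. Proof. by rewrite ler0c mnorm_ge0. Qed.

Lemma mnormC_le a (c : C) : 0 <= c -> (forall h, `|mact a h| <= c * `|h|) ->
  mnormC a <= c.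
Proof.
move=> c0; rewrite -[c]RRe_real ?ger0_real// => Hc; rewrite lecR.
by apply: mnorm_le => //; rewrite -ler0c RRe_real ?ger0_real.
Qed.

Lemma mnormCD a b : mnormC (a + b) <= mnormC a + mnormC b.
Proof.
apply: mnormC_le => [|h]; first by rewrite addr_ge0 ?mnormC_ge0.
have := mact_linearl h 1 a b; rewrite !scale1r => ->.
by rewrite (le_trans (ler_normD _ _))// mulrDl lerD// mnormP.
Qed.

Lemma mactZ z a h : mact (z *: a) h = z *: mact a h.
Proof.
apply/ffunP => x; rewrite !ffunE /GRing.scale /= mulr_sumr.
by apply: eq_bigr => y _; rewrite ffunE mulrA.
Qed.

Lemma mnormCZ z a : mnormC (z *: a) = `|z| * mnormC a.
Proof.
have le w b : mnormC (w *: b) <= `|w| * mnormC b.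
  apply: mnormC_le => [|h]; first by rewrite mulr_ge0 ?mnormC_ge0.
  by rewrite mactZ normrZ -mulrA ler_wpM2l// mnormP.
apply/eqP; rewrite eq_le le /=.
have [->|z0] := eqVneq z 0; first by rewrite normr0 mul0r mnormC_ge0.
have := le z^-1 (z *: a); rewrite scalerA mulVf// scale1r normfV.
by rewrite ler_pdivlMl ?normr_gt0.
Qed.

Lemma mact_single a y : mact a (single _ y) = [ffun x => a (x, y)].
Proof.
apply/ffunP => x; rewrite !ffunE (bigD1 y)//= big1 => [|z zy].
  by rewrite ffunE eqxx mulr1 addr0.
by rewrite ffunE (negbTE zy) mulr0.
Qed.

Lemma norm_single y : `|single (l2 R I) y| = 1.
Proof.
rewrite cspace_normE /= /l2_norm l2_innerE (bigD1 y)//= big1 => [|z zy].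
  by rewrite ffunE eqxx normr1 expr1n addr0 sqrtC1.
by rewrite ffunE (negbTE zy) normr0 expr0n.
Qed.

Lemma mnormC_coord (a : M) p : `|a p| <= mnormC a.
Proof.
case: p => x y; have := mnormP a (single _ y); rewrite norm_single mulr1.
apply: le_trans; have := cn_coord (l2 R I) (mact a (single _ y)) x.
by rewrite mact_single ffunE.
Qed.

Definition op_norm : coord_norm R (I * I)%type :=
  CoordNorm mnormCD mnormCZ mnormC_coord.

Local Notation A := (cspace op_norm).

Definition mmul (a b : A) : A := [ffun p => \sum_z a (p.1, z) * b (z, p.2)].

Lemma mmul_bilinear : bilinear_for *:%R *:%R mmul.
Proof.
split=> [b z a a'|a z b b'] /=; apply/ffunP => p;
    rewrite !ffunE /GRing.scale /= mulr_sumr -big_split; apply: eq_bigr => y _ /=;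
    rewrite !ffunE.
- by rewrite mulrDl mulrA.
- by rewrite mulrDr mulrCA.
Qed.

HB.instance Definition _ := bilinear_isBilinear.Build C A A A _ _ mmul
  mmul_bilinear.

Definition mstar (a : A) : A := [ffun p => Num.conj (a (p.2, p.1))].

Lemma mactM a b h : mact (mmul a b) h = mact a (mact b h).
Proof.
apply/ffunP => x; rewrite !ffunE /=.
under eq_bigr do rewrite ffunE mulr_suml.
rewrite exchange_big; apply: eq_bigr => y _ /=.
by rewrite ffunE mulr_sumr; apply: eq_bigr => z _; rewrite mulrA.
Qed.

Lemma mact_adj a h k : l2_inner (mact a h) k = l2_inner h (mact (mstar a) k).
Proof.
rewrite /l2_inner; under eq_bigr do rewrite ffunE mulr_suml.
rewrite exchange_big; apply: eq_bigr => y _ /=.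
rewrite ffunE rmorph_sum mulr_sumr; apply: eq_bigr => x _ /=.
by rewrite [mstar a _]ffunE /= rmorphM /= conjCK mulrCA mulrA.
Qed.

Lemma mmulA a b c : mmul a (mmul b c) = mmul (mmul a b) c.
Proof.
apply/ffunP => p; rewrite !ffunE /=.
under [RHS]eq_bigr do rewrite ffunE mulr_suml.
rewrite exchange_big; apply: eq_bigr => y _ /=.
by rewrite ffunE mulr_sumr; apply: eq_bigr => z _; rewrite mulrA.
Qed.

Lemma mstarD a b : mstar (a + b) = mstar a + mstar b.
Proof. by apply/ffunP => p; rewrite !ffunE rmorphD. Qed.

Lemma mstarZ z a : mstar (z *: a) = Num.conj z *: mstar a.
Proof. by apply/ffunP => p; rewrite !ffunE rmorphM. Qed.

Lemma mstarK a : mstar (mstar a) = a.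
Proof. by apply/ffunP => -[x y]; rewrite !ffunE /= conjCK. Qed.

Lemma mstarM a b : mstar (mmul a b) = mmul (mstar b) (mstar a).
Proof.
apply/ffunP => p; rewrite !ffunE rmorph_sum; apply: eq_bigr => z _ /=.
by rewrite !ffunE rmorphM mulrC.
Qed.

Lemma mnormM (a b : A) : `|mmul a b| <= `|a| * `|b|.
Proof.
apply: mnormC_le => [|h]; first by rewrite mulr_ge0.
rewrite mactM (le_trans (mnormP _ _))// -mulrA.
by rewrite ler_wpM2l ?mnormC_ge0// mnormP.
Qed.

(** As usual, <ah, ah> = <h, a*ah> and Cauchy-Schwarz give |a|^2 <= |a*a|; then
    |a|^2 <= |a*| |a|, so the involution is isometric. *)
Lemma mnorm_mstar (a : A) : `|mmul (mstar a) a| = `|a| ^+ 2.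
Proof.
have sq (b : A) : `|b| ^+ 2 <= `|mmul (mstar b) b|.
  rewrite -[leRHS]sqrtCK ler_pXn2r ?nnegrE ?sqrtC_ge0//.
  apply: mnormC_le => [|h]; first by rewrite sqrtC_ge0.
  rewrite -(@ler_pXn2r _ 2)//; last 2 first.
  - by rewrite nnegrE.
  - by rewrite nnegrE mulr_ge0// sqrtC_ge0.
  rewrite exprMn [sqrtC `|mmul _ _| ^+ 2]sqrtCK.
  rewrite -[X in X <= _]l2_inner_norm -[leLHS]ger0_norm ?dnorm_ge0//.
  rewrite mact_adj -mactM.
  rewrite (le_trans (CauchySchwarz_sqrt (@l2_inner R I) (h : {ffun I -> C^o}) _))//.
  change (`|h| * `|mact (mmul (mstar b) b) h| <= `|mmul (mstar b) b| * `|h| ^+ 2).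
  by rewrite mulrC expr2 mulrA ler_wpM2r// mnormP.
have star (b : A) : `|b| <= `|mstar b|.
  have [->|b0] := eqVneq b 0; first by rewrite normr0.
  rewrite -(ler_pM2r (x := `|b|)) ?normr_gt0// -expr2.
  exact: le_trans (sq b) (mnormM _ _).
apply/eqP; rewrite eq_le sq andbT expr2 (le_trans (mnormM _ _))//.
by rewrite ler_wpM2r// -{2}(mstarK a) star.
Qed.

Definition matrix_alg : cstarAlg R :=
  @CStarAlg R A (mmul : {bilinear A -> A -> A}) mstar mmulA mstarD mstarZ mstarK
    mstarM mnormM mnorm_mstar.

End MatrixAlgebra.

(** * Direct sums of C*-algebras *)

Section ProdComplete.
Variables (K : numFieldType) (U V : completeNormedModType K).

HB.instance Definition _ := Pointed.on (U * V)%type.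

Lemma prod_complete (F : set_system (U * V)%type) :
  ProperFilter F -> cauchy F -> cvg F.
Proof.
move=> FF Fc.
have /cvg_ex[a Fa] : cvg (fst @ F).
  apply: cauchy_cvg; apply/cauchy_ballP => e e0.
  move/cauchy_ballP : Fc => /(_ _ e0) H; rewrite near_map2.
  by apply: filterS H => -[x y] [].
have /cvg_ex[b Fb] : cvg (snd @ F).
  apply: cauchy_cvg; apply/cauchy_ballP => e e0.
  move/cauchy_ballP : Fc => /(_ _ e0) H; rewrite near_map2.
  by apply: filterS H => -[x y] [].
apply/cvg_ex; exists (a, b).
move=> P /(cvg_pair Fa Fb).
change (F (fun x => P (x.1, x.2)) -> F P).
by rewrite (_ : (fun x => _) = P)//; apply/funext => -[].
Qed.

HB.instance Definition _ := Uniform_isComplete.Build (U * V)%type prod_complete.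
End ProdComplete.

Section DirectSum.
Variables (R : realType) (B C : cstarAlg R).
Local Notation S := (B * C)%type.

Lemma rnorm_pair (x : S) : rnorm x = Num.max (rnorm x.1) (rnorm x.2).
Proof.
apply: complexI; rewrite -rnormE prod_normE !rnormE.
have [h|h] := leP (rnorm x.1) (rnorm x.2); last first.
  by rewrite max_l// lecR ltW.
by rewrite max_r// lecR.
Qed.

Definition dsum_mul (x y : S) : S := (cmul x.1 y.1, cmul x.2 y.2).

Lemma dsum_mul_bilinear : bilinear_for *:%R *:%R dsum_mul.
Proof.
split=> [y z x x'|x z y y'] /=; congr pair; rewrite ?linearPl ?linearPr//.
Qed.

HB.instance Definition _ := bilinear_isBilinear.Build R[i] S S S _ _ dsum_mul
  dsum_mul_bilinear.

Definition dsum_star (x : S) : S := (cstar x.1, cstar x.2).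

Lemma dsum_mulA x y z : dsum_mul x (dsum_mul y z) = dsum_mul (dsum_mul x y) z.
Proof. by rewrite /dsum_mul /= !cmulA. Qed.

Lemma dsum_starD x y : dsum_star (x + y) = dsum_star x + dsum_star y.
Proof. by rewrite /dsum_star /= !cstarD. Qed.

Lemma dsum_starZ (z : R[i]) x : dsum_star (z *: x) = Num.conj z *: dsum_star x.
Proof. by rewrite /dsum_star /= !cstarZ. Qed.

Lemma dsum_starK x : dsum_star (dsum_star x) = x.
Proof. by case: x => x y; rewrite /dsum_star /= !cstarK. Qed.

Lemma dsum_starM x y :
  dsum_star (dsum_mul x y) = dsum_mul (dsum_star y) (dsum_star x).
Proof. by rewrite /dsum_star /dsum_mul /= !cstarM. Qed.

Lemma dsum_normM x y : `|dsum_mul x y| <= `|x| * `|y|.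
Proof.
rewrite !rnormE -rmorphM lecR !rnorm_pair ge_max /=.
have rM (D : cstarAlg R) (a b : D) : rnorm (cmul a b) <= rnorm a * rnorm b.
  by rewrite -lecR rmorphM /= -!rnormE cnormM.
by rewrite !(le_trans (rM _ _ _))//; apply: ler_pM;
  rewrite ?rnorm_ge0// le_max lexx ?orbT.
Qed.

Lemma dsum_norm_star x : `|dsum_mul (dsum_star x) x| = `|x| ^+ 2.
Proof.
rewrite !rnormE -rmorphXn/= !rnorm_pair /=; congr (_%:C).
have rs (D : cstarAlg R) (a : D) : rnorm (cmul (cstar a) a) = rnorm a ^+ 2.
  by apply: complexI; rewrite rmorphXn /= -!rnormE cnorm_cstar.
have a0 := rnorm_ge0 x.1; have b0 := rnorm_ge0 x.2.
rewrite !rs; have [h|h] := leP (rnorm x.1) (rnorm x.2).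
  by rewrite max_r// ler_pXn2r.
by rewrite max_l// ler_pXn2r// ltW.
Qed.

Definition dsum : cstarAlg R :=
  @CStarAlg R S (dsum_mul : {bilinear S -> S -> S}) dsum_star dsum_mulA dsum_starD
    dsum_starZ dsum_starK dsum_starM dsum_normM dsum_norm_star.

Lemma unit_ball_dsum (x : B) (y : C) :
  unit_ball ((x, y) : dsum) <-> unit_ball x /\ unit_ball y.
Proof.
rewrite !unit_ballE (rnorm_pair (x, y)) ge_max; split; first by case/andP.
by case=> -> ->.
Qed.

End DirectSum.

(** * Formulae on direct sums *)

Section Formulae.
Variable R : realType.
Implicit Types A B C : cstarAlg R.

Lemma norm_cstar A (a : A) : `|cstar a| = `|a|.
Proof.
have le (b : A) : `|b| <= `|cstar b|.
  have [->|b0] := eqVneq b 0; first by rewrite normr0.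
  rewrite -(ler_pM2r (x := `|b|)) ?normr_gt0// -expr2 -cnorm_cstar.
  exact: cnormM.
by apply/eqP; rewrite eq_le le -{2}(cstarK a) le.
Qed.

Lemma peval_bounded n (p : starpoly R n) : exists K : R,
  forall A (v : 'I_n -> A), in_ball v -> rnorm (peval v p) <= K.
Proof.
suff [K HK] : exists K : R[i],
    forall A (v : 'I_n -> A), in_ball v -> `|peval v p| <= K.
  exists (complex.Re K) => A v /HK; rewrite rnormE => /[dup] h.
  rewrite -[K]RRe_real ?lecR//; apply: ger0_real; apply: le_trans h.
  by rewrite ler0c rnorm_ge0.
elim: p => [|i|p [K HK] q [L HL]|z p [K HK]|p [K HK] q [L HL]|p [K HK]].
- by exists 0 => A v _ /=; rewrite normr0.
- by exists 1 => A v vb /=; exact: vb.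
- exists (K + L) => A v vb /=; rewrite (le_trans (ler_normD _ _))//.
  by rewrite lerD ?HK ?HL.
- by exists (`|z| * K) => A v vb /=; rewrite normrZ ler_wpM2l ?HK.
- exists (K * L) => A v vb /=; rewrite (le_trans (cnormM _ _))//.
  by rewrite ler_pM ?HK ?HL.
- by exists K => A v vb /=; rewrite norm_cstar HK.
Qed.

Lemma box_compact m (K : R) :
  compact [set x : 'rV[R]_m | forall i, `|x ord0 i| <= K].
Proof.
pose S (i : 'I_m) : set R := `[- K, K]%classic.
have -> : [set x : 'rV[R]_m | forall i, `|x ord0 i| <= K] =
          [set x : 'rV[R]_m | forall i, S i (x ord0 i)].
  apply/seteqP; split=> x /= H i; have := H i.
    by rewrite ler_norml /S /= in_itv.
  by rewrite /S /= in_itv /= ler_norml.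
by apply: rV_compact => i; exact: segment_compact.
Qed.

Lemma box_bounded m (u : 'rV[R]_m -> R) (K : R) : continuous u ->
  exists L : R, forall x : 'rV[R]_m, (forall i, `|x ord0 i| <= K) -> `|u x| <= L.
Proof.
move=> cu; have : compact (u @` [set x : 'rV[R]_m | forall i, `|x ord0 i| <= K]).
  apply: continuous_compact (@box_compact m K).
  exact: continuous_subspaceT.
move=> /compact_bounded [M [_ HM]].
exists (M + 1) => x xK; apply: (HM (M + 1)); first by rewrite ltrDl.
by exists x.
Qed.

Lemma box_unif_continuous m (u : 'rV[R]_m -> R) (K e : R) : continuous u ->
  0 < e -> exists2 d : R, 0 < d & forall x y : 'rV[R]_m,
    (forall i, `|x ord0 i| <= K) -> (forall i, `|x ord0 i - y ord0 i| <= d) ->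
    `|u x - u y| <= e.
Proof.
move=> cu e0; have /compact_near_coveringP cov := @box_compact m K.
have := cov R (0^'+) (fun d x => forall y : 'rV[R]_m,
  (forall i, `|x ord0 i - y ord0 i| <= d) -> `|u x - u y| <= e) _.
case=> [x xK|d /= d0 H]; last first.
  exists (d / 2); first by rewrite divr_gt0.
  move=> x y xK xy; apply: H xK y xy => /=; rewrite ?divr_gt0//.
  by rewrite sub0r normrN gtr0_norm ?divr_gt0// ltr_pdivrMr// ltr_pMr// ltr1n.
have e20 : 0 < e / 2 by rewrite divr_gt0.
have /cvgrPdist_lt/(_ _ e20) := cu x; rewrite -nbhs_ballE => -[r /= r0 Hr].
have r20 : 0 < r / 2 by rewrite divr_gt0.
exists (ball x (r / 2), [set d | d < r / 2]) => /=.
  split; first exact: nbhsx_ballx.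
  exact: nbhs_right_lt.
move=> [z d] /= [xz dr] y zy.
have xy : ball x r y.
  split=> // i j; rewrite ord1 -ball_normE /=.
  have := xz.2 ord0 j; rewrite -ball_normE /= => xzj.
  rewrite -[x ord0 j](subrK (z ord0 j)) -addrA (le_lt_trans (ler_normD _ _))//.
  by rewrite [r in ltRHS]splitr ltrD// (le_lt_trans (zy j)).
have xz' : ball x r z.
  by apply: le_ball xz; rewrite ler_pdivrMr// ler_pMr// ler1n.
have h1 := Hr _ xy; have h2 := Hr _ xz'.
rewrite -[u z](subrK (u x)) -addrA (le_trans (ler_normD _ _))//.
by rewrite distrC [e]splitr ltW// ltrD.
Qed.

(** Colour a real number by the interval of length [e] that contains it. *)
Lemma finite_resolution (K e : R) : 0 < e -> exists N : nat, exists c : R -> 'I_N.+1,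
  forall r s, 0 <= r <= K -> 0 <= s <= K -> c r = c s -> `|r - s| <= e.
Proof.
move=> e0; exists (Num.truncn (K / e)), (fun r => inord (Num.truncn (r / e))).
have inN r : 0 <= r <= K -> (Num.truncn (r / e) < (Num.truncn (K / e)).+1)%N.
  case/andP=> r0 rK; rewrite ltnS le_truncn// ler_pM2r// invr_gt0//.
move=> r s /[dup] /andP[r0 _] /inN rN /[dup] /andP[s0 _] /inN sN.
move=> H; have := congr1 (@nat_of_ord _) H; rewrite !inordK// => {H} E.
have : `|r / e - s / e| <= 1.
  have /truncn_itv : 0 <= r / e by rewrite divr_ge0// ltW.
  have /truncn_itv : 0 <= s / e by rewrite divr_ge0// ltW.
  rewrite E -natr1 ler_norml => /andP[h1 h2] /andP[h3 h4]; lra.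
by rewrite -mulrBl normrM (gtr0_norm (x := e^-1)) ?invr_gt0// ler_pdivrMr// mul1r.
Qed.

Lemma sup_norm_le (S : set R) (K : R) :
  S !=set0 -> (forall s, S s -> `|s| <= K) -> `|sup S| <= K.
Proof.
move=> [s Ss] HK; have SK : ubound S K.
  by move=> t /HK; apply: le_trans; exact: ler_norm.
rewrite ler_norml; apply/andP; split; last by apply: ge_sup => //; exists s.
have /(le_trans _) -> // : s <= sup S.
  by apply: sup_upper_bound => //; split; [exists s|exists K].
by have := HK _ Ss; rewrite ler_norml => /andP[].
Qed.

Lemma sup_close (S T : set R) (K e : R) : S !=set0 -> T !=set0 ->
  (forall s, S s -> `|s| <= K) -> (forall t, T t -> `|t| <= K) ->
  (forall s, S s -> exists2 t, T t & `|s - t| <= e) ->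
  (forall t, T t -> exists2 s, S s & `|s - t| <= e) ->
  `|sup S - sup T| <= e.
Proof.
have half (S' T' : set R) : S' !=set0 -> T' !=set0 ->
    (forall t, T' t -> `|t| <= K) ->
    (forall s, S' s -> exists2 t, T' t & `|s - t| <= e) ->
    sup S' <= sup T' + e.
  move=> S0 T0 TK ST; apply: ge_sup => // s /ST[t Tt].
  rewrite ler_norml lerBlDr => /andP[_ /le_trans] -> //.
  rewrite addrC lerD2r; apply: sup_upper_bound => //; split=> //.
  by exists K => r /TK; apply: le_trans; exact: ler_norm.
move=> S0 T0 SK TK ST TS; rewrite ler_norml lerBlDr lerBrDr addrC lerBlDr.
rewrite half//; last by move=> t /TS[s Ss]; rewrite distrC; exists s.
by rewrite addrC half.
Qed.

Lemma infE (S : set R) : inf S = - sup [set - x | x in S].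
Proof. by []. Qed.

Lemma unit_ball0 A : @unit_ball R A 0.
Proof. by rewrite /unit_ball /= normr0. Qed.

Lemma in_ball_extend A n (v : 'I_n -> A) a :
  in_ball v -> unit_ball a -> in_ball (extend v a).
Proof. by move=> vb ab i; rewrite /extend; case: unliftP => //= j _; exact: vb. Qed.

Lemma interp_bounded n (phi : formula R n) : exists K : R,
  forall A (v : 'I_n -> A), in_ball v -> `|interp phi v| <= K.
Proof.
elim: phi => {n} [n p|n m u cu psi IH|n psi [K HK]|n psi [K HK]] /=.
- have [K HK] := peval_bounded p; exists K => A v vb.
  by rewrite ger0_norm ?rnorm_ge0// HK.
- have [K HK] := choice IH.
  have [L HL] := box_bounded (\sum_i `|K i|) cu.
  exists L => A v vb; apply: HL => i; rewrite mxE (le_trans (HK i A v vb))//.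
  by rewrite (le_trans (ler_norm _))// (bigD1 i)//= lerDl sumr_ge0.
- exists K => A v vb; apply: sup_norm_le.
    by exists (interp psi (extend v 0)), 0 => //; exact: unit_ball0.
  by move=> _ [a ab <-]; apply: HK; exact: in_ball_extend.
- exists K => A v vb; rewrite infE normrN; apply: sup_norm_le.
    exists (- interp psi (extend v 0)), (interp psi (extend v 0)) => //.
    by exists 0 => //; exact: unit_ball0.
  by move=> _ [_ [a ab <-] <-]; rewrite normrN; apply: HK; exact: in_ball_extend.
Qed.

Definition pairv B C n (v : 'I_n -> B) (w : 'I_n -> C) : 'I_n -> dsum B C :=
  fun i => (v i, w i).

Lemma in_ball_pairv B C n (v : 'I_n -> B) (w : 'I_n -> C) :
  in_ball v -> in_ball w -> in_ball (pairv v w).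
Proof. by move=> vb wb i; apply/unit_ball_dsum. Qed.

Lemma extend_pairv B C n (v : 'I_n -> B) (w : 'I_n -> C) x y :
  extend (pairv v w) ((x, y) : dsum B C) = pairv (extend v x) (extend w y).
Proof. by apply/funext => i; rewrite /pairv /extend; case: unliftP. Qed.

Lemma peval_pairv B C n (v : 'I_n -> B) (w : 'I_n -> C) p :
  peval (pairv v w) p = (peval v p, peval w p) :> dsum B C.
Proof.
elim: p => //= [p -> q -> //|z p -> //|p -> q -> //|p -> //].
Qed.

(** The set over which the quantifiers of [Fsup] and [Finf] range. *)
Definition values B C n (psi : formula R n.+1) (v : 'I_n -> B) (w : 'I_n -> C) :=
  [set interp psi (extend (pairv v w) a) | a in @unit_ball R (dsum B C)].

Lemma values_neq0 B C n psi (v : 'I_n -> B) (w : 'I_n -> C) : values psi v w !=set0.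
Proof.
exists (interp psi (extend (pairv v w) (0 : dsum B C))), 0 => //.
exact: unit_ball0.
Qed.

(** The colour of a tuple [v] of [B] determines the value of [phi] up to [e] in
    every direct sum with first summand [B]. *)
Definition resolves n (phi : formula R n) (e : R) (K : Type)
    (c : forall B : cstarAlg R, ('I_n -> B) -> K) :=
  forall B B' (v : 'I_n -> B) (v' : 'I_n -> B'), in_ball v -> in_ball v' ->
    c B v = c B' v' ->
  forall C (w : 'I_n -> C), in_ball w ->
    `|interp phi (pairv v w) - interp phi (pairv v' w)| <= e.

(** The colours of the tuples obtained from [v] by adding a contraction. *)
Definition extension_colours n (K : finType)
    (c : forall B : cstarAlg R, ('I_n.+1 -> B) -> K) B (v : 'I_n -> B) : {set K} :=
  [set t | `[< exists2 x, unit_ball x & c B (extend v x) = t >]].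

(** An element of the ball of [B (+) C] is a pair [(x, y)].  Keep [y] and answer
    [x] by some [x'] in [B'] giving an extension of the same colour: this is one
    round of an Ehrenfeucht-Fraisse game. *)
Lemma values_close n (psi : formula R n.+1) e (K : finType) c :
    @resolves n.+1 psi e K c ->
  forall B B' (v : 'I_n -> B) (v' : 'I_n -> B'), in_ball v -> in_ball v' ->
    extension_colours c v = extension_colours c v' ->
  forall C (w : 'I_n -> C), in_ball w ->
  forall s, values psi v w s -> exists2 t, values psi v' w t & `|s - t| <= e.
Proof.
move=> Hc B B' v v' vb vb' E C w wb _ [[x y] /unit_ball_dsum[xb yb] <-].
have : c B (extend v x) \in extension_colours c v'.
  by rewrite -E inE; apply/asboolP; exists x.
rewrite inE => /asboolP[x' xb' cx'].
exists (interp psi (extend (pairv v' w) ((x', y) : dsum B' C))).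
  by exists (x', y) => //; apply/unit_ball_dsum.
rewrite !extend_pairv; apply: Hc; try exact: in_ball_extend.
by rewrite cx'.
Qed.

(** For an atomic formula the norm in the direct sum is the maximum of the norms
    of the components, so the first norm, up to [e], is a sufficient colour.
    Connectives are uniformly continuous on bounded sets, and the colour of a
    combination collects those of its parts at a finer scale.  For a
    quantifier the colour is the finite set of colours of the extensions. *)
Lemma finite_colouring n (phi : formula R n) (e : R) : 0 < e ->
  exists (K : finType) (c : forall B : cstarAlg R, ('I_n -> B) -> K), resolves phi e c.
Proof.
elim: phi e => {n} [n p|n m u cu psi IH|n psi IH|n psi IH] e e0.
- have [K HK] := peval_bounded p.
  have [N [c Hc]] := finite_resolution K e0.
  exists 'I_N.+1, (fun B v => c (rnorm (peval v p))).
  move=> B B' v v' vb vb' /Hc; rewrite !rnorm_ge0 !HK// => /(_ isT isT) H C w wb.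
  rewrite /= !peval_pairv !rnorm_pair /=; apply: le_trans H.
  set x := rnorm _; set y := rnorm _; set z := rnorm _.
  have [] := leP x y; have [] := leP z y; rewrite ?subrr ?normr0// ler_norml => h h';
    have := ler_norm (x - z); have := ler_norm (z - x); rewrite (distrC z); lra.
- (* The sum of the |K i| bounds all the arguments of [u] at once. *)
  have [K HK] := choice (fun i => interp_bounded (psi i)).
  have [d d0 Hd] := box_unif_continuous (\sum_i `|K i|) cu e0.
  have {}IH i : exists c : {T : finType & forall B : cstarAlg R, ('I_n -> B) -> T},
      resolves (psi i) d (projT2 c).
    by have [T [c Hc]] := IH i d d0; exists (existT _ T c).
  have [c Hc] := choice IH.
  exists {dffun forall i : 'I_m, projT1 (c i)}.
  exists (fun B v => [ffun i => projT2 (c i) B v]).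
  move=> B B' v v' vb vb' /ffunP E C w wb /=; apply: Hd => i; rewrite !mxE.
    rewrite (le_trans (HK i _ _ (in_ball_pairv vb wb)))// (le_trans (ler_norm _))//.
    by rewrite (bigD1 i)//= lerDl sumr_ge0.
  by apply: Hc => //; have := E i; rewrite !ffunE.
- have [T [c Hc]] := IH e e0; have [K HK] := interp_bounded psi.
  exists {set T}, (extension_colours c) => B B' v v' vb vb' E C w wb /=.
  have bounded A (u : 'I_n -> A) : in_ball u -> forall s, values psi u w s -> `|s| <= K.
    move=> ub _ [a ab <-]; apply: HK.
    by apply: in_ball_extend ab; exact: in_ball_pairv.
  apply: (@sup_close (values psi v w) (values psi v' w) K e); try exact: values_neq0.
  + exact: bounded.
  + exact: bounded.
  + exact: (values_close Hc vb vb' E wb).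
  + move=> t /(values_close Hc vb' vb (esym E) wb)[s ? ?].
    by exists s => //; rewrite distrC.
- have [T [c Hc]] := IH e e0; have [K HK] := interp_bounded psi.
  exists {set T}, (extension_colours c) => B B' v v' vb vb' E C w wb /=.
  have bounded A (u : 'I_n -> A) : in_ball u -> forall s, values psi u w s -> `|s| <= K.
    move=> ub _ [a ab <-]; apply: HK.
    by apply: in_ball_extend ab; exact: in_ball_pairv.
  rewrite !infE -opprD normrN.
  have neq0 A (u : 'I_n -> A) : [set - x | x in values psi u w] !=set0.
    by have [x Sx] := values_neq0 psi u w; exists (- x), x.
  apply: (@sup_close [set - x | x in values psi v w]
                     [set - x | x in values psi v' w] K e);
    try exact: neq0.
  + by move=> _ [s /bounded sK <-]; rewrite normrN; exact: sK.
  + by move=> _ [s /bounded sK <-]; rewrite normrN; exact: sK.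
  + move=> _ [s /(values_close Hc vb vb' E wb)[t tS st] <-].
    by exists (- t); [exists t|rewrite -opprD normrN].
  + move=> _ [t /(values_close Hc vb' vb (esym E) wb)[s sS st] <-].
    by exists (- s); [exists s|rewrite -opprD normrN distrC].
Qed.

End Formulae.

(** * Realized functions *)

Section Realized.
Variable R : realType.

Lemma models_cstar_theory (A : cstarAlg R) : models (cstar_theory R) A.
Proof. by move=> sigma H v; exact: H. Qed.

(** Formulae being bounded uniformly over all C*-algebras, the supremum that
    defines [dT] is that of a bounded set. *)
Lemma dT_ge n (phi psi : formula R n) (A : cstarAlg R) (v : 'I_n -> A) :
  in_ball v -> `|interp phi v - interp psi v| <= dT (cstar_theory R) phi psi.
Proof.
move=> vb; have [K HK] := interp_bounded phi; have [L HL] := interp_bounded psi.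
apply: sup_upper_bound; last first.
  by exists A, v; split => //; exact: models_cstar_theory.
split.
  by exists `|interp phi v - interp psi v|, A, v; split=> //; exact: models_cstar_theory.
exists (K + L) => _ [B [w [_ wb ->]]].
by rewrite (le_trans (ler_normB _ _))// lerD ?HK ?HL.
Qed.

Lemma tinterp_approx n (phi : Tformula (cstar_theory R) n) (e : R) : 0 < e ->
  exists psi : formula R n, forall (A : cstarAlg R) (v : 'I_n -> A), in_ball v ->
    `|tinterp phi v - interp psi v| <= e.
Proof.
move=> e0; have [N HN] := tf_cauchy phi e0; exists (tf_seq phi N) => A v vb.
pose u k := interp (tf_seq phi k) v.
have cu : cvg (u @ \oo).
  apply: cauchy_cvg; apply: cauchy_exP => d d0.
  have [M HM] := tf_cauchy phi d0; exists (u M); exists M => // k Mk.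
  rewrite -ball_normE /=; apply: le_lt_trans (dT_ge _ _ vb) _.
  exact: HM.
rewrite /tinterp -/u.
have h : \forall k \near \oo, u k <= u N + e /\ u N - e <= u k.
  near=> k.
  have : `|u k - u N| <= e.
    rewrite (le_trans (dT_ge _ _ vb))// ltW// HN//.
    by near: k; exact: nbhs_infty_ge.
  rewrite ler_norml => /andP[h1 h2]; split; lra.
have l1 : lim (u @ \oo) <= u N + e.
  by apply: limr_le => //; apply: filterS h => k [].
have l2 : u N - e <= lim (u @ \oo).
  by apply: limr_ge => //; apply: filterS h => k [].
by rewrite ler_norml lerBrDl l2 lerBlDl l1.
Unshelve. all: by end_near. Qed.

(** A T-formula is a uniform limit of formulae. *)
Lemma realized_colouring n (P : forall A : cstarAlg R, ('I_n -> A) -> R) (e : R) :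
  realized (cstar_theory R) P -> 0 < e ->
  exists (K : finType) (c : forall B : cstarAlg R, ('I_n -> B) -> K),
  forall (B B' : cstarAlg R) (v : 'I_n -> B) (v' : 'I_n -> B'),
    in_ball v -> in_ball v' -> c B v = c B' v' ->
  forall (C : cstarAlg R) (w : 'I_n -> C), in_ball w ->
    `|P _ (pairv v w) - P _ (pairv v' w)| <= e.
Proof.
move=> [phi HP] e0; have e30 : 0 < e / 3 by rewrite divr_gt0.
have [psi Hpsi] := tinterp_approx phi e30.
have [K [c Hc]] := finite_colouring psi e30.
exists K, c => B B' v v' vb vb' E C w wb.
have bp := in_ball_pairv vb wb; have bp' := in_ball_pairv vb' wb.
rewrite !HP//; try exact: models_cstar_theory.
have := Hpsi _ _ bp; have := Hpsi _ _ bp'; have := Hc _ _ _ _ vb vb' E _ _ wb.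
rewrite !ler_norml => /andP[h1 h2] /andP[h3 h4] /andP[h5 h6].
by apply/andP; split; lra.
Qed.

End Realized.

(** * A gap forced by a paradoxical decomposition *)

Section MassTransport.
Variables (R : realFieldType) (Z : finType).
Implicit Types (f b c : Z -> R) (s t u : Z -> Z) (D P : pred Z).

Definition mass P f : R := \sum_z (P z)%:R * f z ^+ 2.

Let sum_inj (g : Z -> R) u : injective u -> \sum_z g (u z) = \sum_z g z.
Proof. by move=> u_inj; rewrite [RHS](reindex_inj u_inj). Qed.

Lemma sum_sqr_translate f b u : injective u -> (forall z, b (u z) = f z) ->
  \sum_z b z ^+ 2 = \sum_z f z ^+ 2.
Proof.
move=> u_inj bu; rewrite -(sum_inj (fun z => b z ^+ 2) u_inj).
by apply: eq_bigr => z _; rewrite bu.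
Qed.

(** Minkowski for three vectors of norm at most that of [f]. *)
Lemma three_term_bound D s t f b c : injective s -> injective t ->
  (forall z, b (s z) = f z) -> (forall z, c (t z) = f z) ->
  \sum_z ((D z)%:R * f z + b z + c z) ^+ 2 <= 9 * \sum_z f z ^+ 2.
Proof.
move=> s_inj t_inj bs ct.
have -> : 9 * \sum_z f z ^+ 2 =
    3 * \sum_z f z ^+ 2 + 3 * \sum_z b z ^+ 2 + 3 * \sum_z c z ^+ 2.
  by rewrite (sum_sqr_translate s_inj bs) (sum_sqr_translate t_inj ct); ring.
rewrite !mulr_sumr -!big_split; apply: ler_sum => z _ /=.
move: (f z) (b z) (c z) => x y w.
have := sqr_ge0 (y - w); have := sqr_ge0 (x - y); have := sqr_ge0 (x - w).
by case: (D z) => /=; rewrite ?mul1r ?mul0r; nra.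
Qed.

(** [b] is the translate of [f] by [u].  If it is close to the restriction of
    [f] to [D], then the mass of [f] on [P] is found again on the part of
    [u P] inside [D].  The constants come from
    x^2 <= (3/2) y^2 + 3 (y - x)^2. *)
Lemma mass_forward D f b u P (P1 : pred Z) :
  injective u -> (forall z, b (u z) = f z) ->
  (forall z, P z -> D (u z) -> P1 (u z)) ->
  mass P f <= 3 / 2 * mass P1 f + 3 * \sum_z ((D z)%:R * f z - b z) ^+ 2.
Proof.
move=> u_inj bu uP.
rewrite /mass -(sum_inj (fun z => (P1 z)%:R * f z ^+ 2) u_inj).
rewrite -(sum_inj (fun z => ((D z)%:R * f z - b z) ^+ 2) u_inj).
rewrite !mulr_sumr -big_split /=; apply: ler_sum => z _; rewrite bu.
have := uP z; move: (f z) (f (u z)) => x y.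
have := sqr_ge0 (2 * x - 3 * y); have := sqr_ge0 x; have := sqr_ge0 y.
have := sqr_ge0 (y - x).
case: (P z); case: (D _); case: (P1 _) => /= h0 h1 h2 h3 H;
  try (by have := H isT isT); nra.
Qed.

(** The same comparison along the inverse of [u]; the mass may now also come
    from the complement of [D]. *)
Lemma mass_backward D f b u P (P1 : pred Z) :
  injective u -> (forall z, b (u z) = f z) ->
  (forall z, P z -> D z) -> (forall z, P (u z) -> D z -> P1 z) ->
  mass P f <= 3 / 2 * (mass P1 f + mass (predC D) f) +
              3 * \sum_z ((D z)%:R * f z - b z) ^+ 2.
Proof.
move=> u_inj bu PD uP.
rewrite /mass -big_split /= -(sum_inj (fun z => (P z)%:R * f z ^+ 2) u_inj).
rewrite -(sum_inj (fun z => ((D z)%:R * f z - b z) ^+ 2) u_inj).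
rewrite !mulr_sumr -big_split /=; apply: ler_sum => z _; rewrite bu.
have := uP z; have := PD (u z); move: (f z) (f (u z)) => x y.
have := sqr_ge0 (2 * y - 3 * x); have := sqr_ge0 x; have := sqr_ge0 y.
have := sqr_ge0 (y - x).
case: (P (u z)); case: (D (u z)); case: (P1 _); case: (D z) => /= h0 h1 h2 h3 H' H;
  try (by have := H isT isT); try (by have := H' isT); nra.
Qed.

Definition packs (P1 P2 : pred Z) P : Prop :=
  forall z, (P1 z ==> P z) && (P2 z ==> P z) && ~~ (P1 z && P2 z).

Lemma mass_packs (P1 P2 : pred Z) P f : packs P1 P2 P -> mass P1 f + mass P2 f <= mass P f.
Proof.
move=> HP; rewrite -big_split; apply: ler_sum => z _ /=.
have := HP z; have := sqr_ge0 (f z).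
by case: (P z); case: (P1 z); case: (P2 z) => //=;
  rewrite ?mul1r ?mul0r ?addr0 ?add0r.
Qed.

(** Split [D] into [Q] and [Q'].  The translations [s] and [t] carry [Q] into
    two disjoint pieces of [Q], and their inverses carry [Q'] into two disjoint
    pieces of [Q'].  If [f] restricted to [D] and its two translates [b] and [c]
    nearly coincided, then [Q] would carry nearly twice its own mass, hence
    almost none, and likewise [Q'] and therefore [D]; but then the restriction
    of [f] to [D] would be small.  So the three vectors are not nearly equal,
    and their sum has norm strictly below 3 |f|. *)
Lemma paradoxical_gap s t D (Q Q' Q1 Q2 Q1' Q2' : pred Z) f b c :
  injective s -> injective t ->
  (forall z, D z = Q z || Q' z) -> (forall z, ~~ (Q z && Q' z)) ->
  packs Q1 Q2 Q -> packs Q1' Q2' Q' ->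
  (forall z, Q z -> D (s z) -> Q1 (s z)) ->
  (forall z, Q z -> D (t z) -> Q2 (t z)) ->
  (forall z, Q' (s z) -> D z -> Q1' z) ->
  (forall z, Q' (t z) -> D z -> Q2' z) ->
  (forall z, b (s z) = f z) -> (forall z, c (t z) = f z) ->
  \sum_z ((D z)%:R * f z + b z + c z) ^+ 2 <= (9 - 1 / 12) * \sum_z f z ^+ 2.
Proof.
move=> s_inj t_inj DQ QQ' /(mass_packs f) Q12 /(mass_packs f) Q12'.
move=> sQ tQ sQ' tQ' bs ct.
have q1 := mass_forward s_inj bs sQ.
have q2 := mass_forward t_inj ct tQ.
have Q'D z : Q' z -> D z by rewrite DQ orbC => ->.
have q1' := mass_backward s_inj bs Q'D sQ'.
have q2' := mass_backward t_inj ct Q'D tQ'.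
have total : \sum_z f z ^+ 2 = mass Q f + mass Q' f + mass (predC D) f.
  rewrite -!big_split; apply: eq_bigr => z _ /=.
  by have := QQ' z; rewrite DQ; case: (Q z); case: (Q' z) => //= _; ring.
have sb := sum_sqr_translate s_inj bs; have sc := sum_sqr_translate t_inj ct.
have defect : \sum_z ((D z)%:R * f z + b z + c z) ^+ 2 +
    \sum_z ((D z)%:R * f z - b z) ^+ 2 + \sum_z ((D z)%:R * f z - c z) ^+ 2 +
    3 * mass (predC D) f <=
    3 * \sum_z f z ^+ 2 + 3 * \sum_z b z ^+ 2 + 3 * \sum_z c z ^+ 2.
  rewrite /mass !mulr_sumr -!big_split; apply: ler_sum => z _ /=.
  move: (f z) (b z) (c z) => x y w; have := sqr_ge0 (y - w).
  by case: (D z) => /=; rewrite ?mul1r ?mul0r; nra.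
have outside_ge0 : 0 <= mass (predC D) f.
  by apply: sumr_ge0 => z _; rewrite mulr_ge0 ?sqr_ge0 ?ler0n.
(* What is left is linear in the masses and the sums of squares. *)
move: q1 q2 q1' q2' Q12 Q12' total sb sc defect outside_ge0.
move: (\sum_z _ ^+ 2) (\sum_z f z ^+ 2) (\sum_z b z ^+ 2) (\sum_z c z ^+ 2).
move: (\sum_z ((D z)%:R * f z - b z) ^+ 2) (\sum_z ((D z)%:R * f z - c z) ^+ 2).
move: (mass _ _) (mass _ _) (mass _ _) (mass _ _) (mass _ _) (mass _ _) (mass _ _).
by move=> *; lra.
Qed.

End MassTransport.

(** * Shears on discrete tori *)

(** The modulus is [n.+1], so that ['I_n.+1] carries its group structure. *)
Definition torus (n : nat) : finType := ('I_n.+1 * 'I_n.+1)%type.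

Definition shear1 n (v : torus n) : torus n := (v.1 + v.2, v.2).
Definition shear2 n (v : torus n) : torus n := (v.1, v.1 + v.2).

Lemma shear1_inj n : injective (@shear1 n).
Proof.
move=> [a b] [c d] /eqP; rewrite xpair_eqE /= => /andP[/[swap] /eqP -> /eqP E].
by rewrite (addIr d E).
Qed.

Lemma shear2_inj n : injective (@shear2 n).
Proof.
move=> [a b] [c d] /eqP; rewrite xpair_eqE /= => /andP[/eqP -> /eqP E].
by rewrite (addrI c E).
Qed.

(** The third of the circle that contains [a / n.+1]. *)
Definition cell n (a : 'I_n.+1) : 'I_3 := inord ((3 * a) %/ n.+1).

Definition box n (v : torus n) : 'I_3 * 'I_3 := (cell v.1, cell v.2).

Definition origin n : torus n := (ord0, ord0).

Lemma cellP n (a : 'I_n.+1) :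
  (cell a * n.+1 <= 3 * a)%N /\ (3 * a < (cell a).+1 * n.+1)%N.
Proof.
have an := ltn_ord a.
have -> : cell a = ((3 * a) %/ n.+1)%N :> nat.
  by rewrite inordK// ltn_divLR// ltn_mul2l.
by rewrite leq_divM ltn_ceil.
Qed.

Section Pairs.
Variables p q : nat.
Local Notation Z := (torus p * torus q)%type.

Definition shear1_pair (z : Z) : Z := (shear1 z.1, shear1 z.2).
Definition shear2_pair (z : Z) : Z := (shear2 z.1, shear2 z.2).

Lemma shear1_pair_inj : injective shear1_pair.
Proof.
move=> [a b] [c d] /eqP; rewrite xpair_eqE /= => /andP[/eqP E /eqP F].
by rewrite (shear1_inj E) (shear1_inj F).
Qed.

Lemma shear2_pair_inj : injective shear2_pair.
Proof.
move=> [a b] [c d] /eqP; rewrite xpair_eqE /= => /andP[/eqP E /eqP F].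
by rewrite (shear2_inj E) (shear2_inj F).
Qed.

(** The pairs on which the sum of the tensor squares of the box projections acts
    as the identity; it vanishes on the others. *)
Definition same_box (z : Z) : bool :=
  [&& z.1 != origin p, z.2 != origin q & box z.1 == box z.2].

(** [a / p.+1 - b / q.+1], scaled by [p.+1 * q.+1]. *)
Definition diff (a : 'I_p.+1) (b : 'I_q.+1) : int := (q.+1 * a)%:Z - (p.+1 * b)%:Z.

Lemma diff_small a b : cell a = cell b -> 3 * `|diff a b| < (p.+1 * q.+1)%:Z.
Proof.
move=> E; have [a1 a2] := cellP a; have [] := cellP b; rewrite -E => b1 b2.
rewrite /diff; move: (nat_of_ord (cell a)) a1 a2 b1 b2 => k.
move: (nat_of_ord a) (nat_of_ord b) => {E}x y; nia.
Qed.

(** Reduction modulo [p.+1] and [q.+1] could only change the difference by a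
    multiple of [p.+1 * q.+1], and all three differences are less than a third of
    that number. *)
Lemma diff_add a b a' b' : cell a = cell b -> cell a' = cell b' ->
  cell (a + a') = cell (b + b') ->
  diff (a + a') (b + b') = diff a b + diff a' b'.
Proof.
move=> /diff_small h1 /diff_small h2 /diff_small.
have -> : diff (a + a') (b + b') = diff a b + diff a' b' -
    (p.+1 * q.+1)%:Z * (((a + a') %/ p.+1)%N%:Z - ((b + b') %/ q.+1)%N%:Z).
    rewrite /diff /= !PoszM.
  have := divn_eq (a + a') p.+1; have := divn_eq (b + b') q.+1.
  set u := ((a + a') %/ _)%N; set v := ((b + b') %/ _)%N.
  move: ((a + a') %% _)%N ((b + b') %% _)%N => r s Eb Ea.
  have -> : r%:Z = a%:Z + a'%:Z - u%:Z * p.+1%:Z by rewrite -PoszM -PoszD Ea; lia.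
  have -> : s%:Z = b%:Z + b'%:Z - v%:Z * q.+1%:Z by rewrite -PoszM -PoszD Eb; lia.
  ring.
move: h1 h2; move: (diff a b) (diff a' b') (_%:Z - _%:Z) => x y m.
have : (0 < p.+1 * q.+1)%N by [].
move: (p.+1 * q.+1)%N => N N0 h1 h2 h3.
have -> : m = 0 by nia.
by rewrite mulr0 subr0.
Qed.

Lemma diff_neq0 z : coprime p.+1 q.+1 -> same_box z ->
  (diff z.1.1 z.2.1 != 0) || (diff z.1.2 z.2.2 != 0).
Proof.
move=> co /and3P[z0 _ _]; rewrite -negb_and; apply: contra z0.
have eq0 (a : 'I_p.+1) (b : 'I_q.+1) : diff a b == 0 -> a = ord0.
  rewrite /diff subr_eq0 eqz_nat => /eqP E; apply: val_inj => /=.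
  have : (p.+1 %| q.+1 * a)%N by rewrite E dvdn_mulr.
  rewrite Gauss_dvdr// => /dvdn_leq; have := ltn_ord a.
  case: (nat_of_ord a) => // k; lia.
case: z => -[a b] w /= /andP[/eq0 -> /eq0 ->] //.
Qed.

Let d1 (z : Z) := diff z.1.1 z.2.1.
Let d2 (z : Z) := diff z.1.2 z.2.2.

Lemma diff_shear1 z : same_box z -> same_box (shear1_pair z) ->
  d1 (shear1_pair z) = d1 z + d2 z /\ d2 (shear1_pair z) = d2 z.
Proof.
case: z => -[a b] [c d] /and3P[_ _ /eqP[E1 E2]] /and3P[_ _ /eqP[E3 _]].
by split=> //; rewrite /d1 /d2 /= diff_add.
Qed.

Lemma diff_shear2 z : same_box z -> same_box (shear2_pair z) ->
  d1 (shear2_pair z) = d1 z /\ d2 (shear2_pair z) = d1 z + d2 z.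
Proof.
case: z => -[a b] [c d] /and3P[_ _ /eqP[E1 E2]] /and3P[_ _ /eqP[_ E3]].
by split=> //; rewrite /d1 /d2 /= diff_add.
Qed.

(** The half-open choice of axes makes the images of the two shears disjoint. *)
Let same_sign (x y : int) := (x != 0) && ((0 <= x) && (0 <= y) || (x <= 0) && (y <= 0)).

(** The difference [(d1, d2)] of a pair in the same box moves by the linear shears
    as long as the pair stays in the same box, and it is never zero.  The shears
    send [Q], where [d1] and [d2] have the same sign, into its parts
    |d2| < |d1| and |d1| <= |d2|; the inverse shears do the same for
    the rest [Q'], with the inequalities exchanged. *)
Lemma pair_gap (R : realFieldType) (f b c : Z -> R) : coprime p.+1 q.+1 ->
  (forall z, b (shear1_pair z) = f z) -> (forall z, c (shear2_pair z) = f z) ->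
  \sum_z ((same_box z)%:R * f z + b z + c z) ^+ 2 <=
    (9 - 1 / 12) * \sum_z f z ^+ 2.
Proof.
move=> co.
pose Q z := same_box z && same_sign (d1 z) (d2 z).
pose Q' z := same_box z && ~~ same_sign (d1 z) (d2 z).
apply: (@paradoxical_gap R _ shear1_pair shear2_pair same_box Q Q'
  (fun z => Q z && (`|d2 z| < `|d1 z|)) (fun z => Q z && (`|d1 z| <= `|d2 z|))
  (fun z => Q' z && (`|d2 z| <= `|d1 z|)) (fun z => Q' z && (`|d1 z| < `|d2 z|))
  _ _ _ shear1_pair_inj shear2_pair_inj)
  => z; rewrite /=.
- by rewrite /Q /Q'; case: (same_box z); case: (same_sign _ _).
- by rewrite /Q /Q'; case: (same_box z); case: (same_sign _ _).
- by rewrite ltNge; case: (Q z); case: (_ <= _).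
- by rewrite ltNge; case: (Q' z); case: (_ <= _).
- rewrite /Q /same_sign => /andP[zD zS] szD; have [-> ->] := diff_shear1 zD szD.
  rewrite szD /=; move: (d1 z) (d2 z) zS => x y; lia.
- rewrite /Q /same_sign => /andP[zD zS] szD; have [-> ->] := diff_shear2 zD szD.
  rewrite szD /=; move: (d1 z) (d2 z) zS => x y; lia.
- rewrite /Q' /same_sign => /andP[szD zS] zD; move: (diff_neq0 co zD) zS.
  have [-> ->] := diff_shear1 zD szD; rewrite zD /= -/(d1 z) -/(d2 z).
  move: (d1 z) (d2 z) => x y; lia.
- rewrite /Q' /same_sign => /andP[szD zS] zD; move: (diff_neq0 co zD) zS.
  have [-> ->] := diff_shear2 zD szD; rewrite zD /= -/(d1 z) -/(d2 z).
  move: (d1 z) (d2 z) => x y; lia.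
Qed.

End Pairs.

(** * Representations of tensor products of matrix algebras *)

Section SpecialMatrices.
Variables (R : realType) (X : finType).
Local Notation M := (matrix_alg R X).

Definition diagm (P : pred X) : M := [ffun p => ((p.1 == p.2) && P p.1)%:R].
Definition permm (s : X -> X) : M := [ffun p => (p.1 == s p.2)%:R].

Lemma diagm_star P : cstar (diagm P) = diagm P.
Proof.
apply/ffunP => -[x y]; rewrite !ffunE /= conjC_nat eq_sym.
by case: eqP => // ->.
Qed.

Lemma diagm_mulE P (a : M) : cmul (diagm P) a = [ffun p => (P p.1)%:R * a p].
Proof.
apply/ffunP => -[x y]; rewrite !ffunE /= (bigD1 x)//= big1 => [|z zx].
  by rewrite ffunE eqxx addr0.
by rewrite ffunE /= eq_sym (negbTE zx) mul0r.
Qed.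

Lemma diagm_mull (a : M) : cmul (diagm xpredT) a = a.
Proof. by rewrite diagm_mulE; apply/ffunP => p; rewrite ffunE mul1r. Qed.

Lemma diagm_unit_mul x P :
  cmul (diagm (pred1 x)) (diagm P) = (P x)%:R *: diagm (pred1 x).
Proof.
rewrite diagm_mulE; apply/ffunP => -[y z]; rewrite !ffunE /= /GRing.scale /=.
have [->|yx] := eqVneq y x; last by rewrite mul0r andbF mulr0.
by rewrite mul1r; case: (x == z); rewrite /= ?mulr0 ?mulr1.
Qed.

Lemma diagm_sum : diagm xpredT = \sum_x diagm (pred1 x) :> M.
Proof.
apply/ffunP => -[y z]; rewrite sum_ffunE (bigD1 y)//= big1 => [|x xy].
  by rewrite !ffunE /= eqxx addr0.
by rewrite ffunE /= [y == x]eq_sym (negbTE xy) andbF.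
Qed.

Variable s : X -> X.
Hypothesis s_inj : injective s.

Lemma permm_unit x :
  cmul (diagm (pred1 (s x))) (permm s) = cmul (permm s) (diagm (pred1 x)).
Proof.
rewrite diagm_mulE; apply/ffunP => -[y z]; rewrite !ffunE /=.
rewrite (bigD1 z)//= big1 => [|w wz].
  rewrite !ffunE /= eqxx addr0 /= -!natrM !mulnb; congr (_ %:R).
  by have [->|] := eqVneq y (s z); rewrite ?andbF// (inj_eq s_inj) andbT.
by rewrite !ffunE /= (negbTE wz) mulr0.
Qed.

Lemma permm_star : cmul (cstar (permm s)) (permm s) = diagm xpredT.
Proof.
apply/ffunP => -[y z]; rewrite !ffunE /= (bigD1 (s z))//= big1 => [|w wz].
  by rewrite !ffunE /= eqxx addr0 mulr1 conjC_nat andbT (inj_eq s_inj) eq_sym.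
by rewrite !ffunE /= (negbTE wz) mulr0.
Qed.

End SpecialMatrices.

Section TensorRep.
Variables (R : realType) (A B : cstarAlg R) (L : hilbert R) (theta : tensor_rep A B L).

Lemma trepDl a a' b h : theta (a + a') b h = theta a b h + theta a' b h.
Proof. by have := trep_linearl theta b h 1 a a'; rewrite !scale1r. Qed.

Lemma trepZl z a b h : theta (z *: a) b h = z *: theta a b h.
Proof.
have /= h0 := trep_linearl theta b h (-1) 0 0.
have := trep_linearl theta b h z a 0; rewrite addr0 /= => ->.
by move: h0; rewrite scaler0 addr0 scaleN1r addNr => ->; rewrite addr0.
Qed.

Lemma trepZr z a b h : theta a (z *: b) h = z *: theta a b h.
Proof.
have /= h0 := trep_linearr theta a h (-1) 0 0.
have := trep_linearr theta a h z b 0; rewrite addr0 /= => ->.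
by move: h0; rewrite scaler0 addr0 scaleN1r addNr => ->; rewrite addr0.
Qed.

Lemma trepDr a b b' h : theta a (b + b') h = theta a b h + theta a b' h.
Proof. by have := trep_linearr theta a h 1 b b'; rewrite !scale1r. Qed.

Lemma trep_suml (I : finType) (F : I -> A) b h :
  theta (\sum_i F i) b h = \sum_i theta (F i) b h.
Proof.
have h0 : theta 0 b h = 0 by have := trepZl 0 0 b h; rewrite !scale0r.
by elim/big_ind2 : _ => // a u a' u' <- <-; rewrite trepDl.
Qed.

Lemma trep_sumr (I : finType) (F : I -> B) a h :
  theta a (\sum_i F i) h = \sum_i theta a (F i) h.
Proof.
have h0 : theta a 0 h = 0 by have := trepZr 0 a 0 h; rewrite !scale0r.
by elim/big_ind2 : _ => // b u b' u' <- <-; rewrite trepDr.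
Qed.

End TensorRep.

(** For a representation of the tensor product of two matrix algebras, the [e z]
    below, for the diagonal matrix units, are orthogonal projections with sum
    [E], the image of the unit.  The representation may be degenerate, so [E]
    need not be the identity. *)
Section MatrixTensorRep.
Variables (R : realType) (X Y : finType) (L : hilbert R).
Variable theta : tensor_rep (matrix_alg R X) (matrix_alg R Y) L.
Local Notation Z := (X * Y)%type.

Let e (z : Z) (h : L) : L := theta (diagm R (pred1 z.1)) (diagm R (pred1 z.2)) h.
Let E (h : L) : L := theta (diagm R xpredT) (diagm R xpredT) h.

Let e_mul z a b h : e z (theta a b h) =
  theta (cmul (diagm R (pred1 z.1)) a) (cmul (diagm R (pred1 z.2)) b) h.
Proof. by rewrite /e trepM. Qed.

Let e_diag z P Q h :
  e z (theta (diagm R P) (diagm R Q) h) = (P z.1 && Q z.2)%:R *: e z h.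
Proof.
by rewrite e_mul !diagm_unit_mul trepZl trepZr scalerA -natrM mulnb.
Qed.

Let e_idem z h : e z (e z h) = e z h.
Proof. by rewrite {2}/e e_diag /= !eqxx scale1r. Qed.

Let e_E z h : e z (E h) = e z h.
Proof. by rewrite e_diag scale1r. Qed.

Let E_trep a b h : E (theta a b h) = theta a b h.
Proof. by rewrite /E -trepM !diagm_mull. Qed.

Let E_sum h : E h = \sum_z e z h.
Proof.
rewrite /E !diagm_sum trep_suml -(pair_bigA _ (fun x y => e (x, y) h)) /=.
by apply: eq_bigr => x _; rewrite trep_sumr.
Qed.

Let e_adj z h k : inner L (e z h) k = inner L h (e z k).
Proof. by rewrite /e trep_adj !diagm_star. Qed.

Let E_adj h k : inner L (E h) k = inner L h (E k).
Proof. by rewrite /E trep_adj !diagm_star. Qed.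

Let rnorm_sqr (h : L) : (rnorm h ^+ 2)%:C = inner L h h.
Proof. by rewrite inner_norm rnormE rmorphXn. Qed.

(** This holds on the essential subspace only; in general there is Bessel's
    inequality. *)
Let parseval (k : L) : E k = k -> rnorm k ^+ 2 = \sum_z rnorm (e z k) ^+ 2.
Proof.
move=> Ek; apply: complexI; rewrite rmorph_sum /= rnorm_sqr -{2}Ek E_sum raddf_sum.
by apply: eq_bigr => z _; rewrite rnorm_sqr e_adj e_idem.
Qed.

Let bessel (h : L) : \sum_z rnorm (e z h) ^+ 2 <= rnorm h ^+ 2.
Proof.
have EE : E (E h) = E h by rewrite {2}/E E_trep.
rewrite (eq_bigr (fun z => rnorm (e z (E h)) ^+ 2)) => [|z _]; last by rewrite e_E.
rewrite -parseval// -lecR !rnorm_sqr.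
have Eh_h : inner L (E h) h = inner L (E h) (E h) by rewrite -{1}EE E_adj.
have h_Eh : inner L h (E h) = inner L (E h) (E h) by rewrite -{1}EE -E_adj.
have -> : inner L h h = inner L (E h) (E h) + inner L (h - E h) (h - E h).
  by rewrite linearBl !linearBr /= Eh_h h_Eh subrr subr0 addrC subrK.
by rewrite lerDl; exact: dnorm_ge0.
Qed.

(** The permutation matrices act unitarily on the essential subspace and
    permute the projections [e z]. *)
Let perm_coord (s : X -> X) (t : Y -> Y) z h : injective s -> injective t ->
  rnorm (e (s z.1, t z.2) (theta (permm R s) (permm R t) h)) = rnorm (e z h).
Proof.
move=> s_inj t_inj; rewrite e_mul /= !permm_unit// trepM -/(e z h).
apply/eqP; rewrite -(@eqrXn2 _ 2) ?rnorm_ge0//; apply/eqP/complexI.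
rewrite !rnorm_sqr trep_adj -trepM !permm_star//.
by rewrite -/(E _) {2}/e E_trep.
Qed.

Let rnormD (h k : L) : rnorm (h + k) <= rnorm h + rnorm k.
Proof. by rewrite -lecR rmorphD /= -!rnormE ler_normD. Qed.

Let rnormZ_nat (n : nat) (h : L) : rnorm (n%:R *: h) = n%:R * rnorm h.
Proof.
by apply: complexI; rewrite rmorphM /= -!rnormE normrZ normr_nat rmorph_nat.
Qed.

(** Passing from a vector [h] to the function z |-> |e z h| turns an arbitrary
    representation into an inequality for real functions on [X * Y]: the
    components of the image of [h] are bounded by the triangle inequality, and
    translation by [s] and [s'] acts on the function. *)
Lemma tensor_op_bound (I : finType) (P : I -> pred X) (Q : I -> pred Y)
    (s t : X -> X) (s' t' : Y -> Y) (D : pred Z) (kappa : R) (h : L) :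
  injective s -> injective t -> injective s' -> injective t' -> 0 <= kappa ->
  (forall z, \sum_i (P i z.1 && Q i z.2) = D z)%N ->
  (forall f b c : Z -> R,
     (forall z, b (s z.1, s' z.2) = f z) -> (forall z, c (t z.1, t' z.2) = f z) ->
     \sum_z ((D z)%:R * f z + b z + c z) ^+ 2 <= kappa * \sum_z f z ^+ 2) ->
  rnorm (\sum_i theta (diagm R (P i)) (diagm R (Q i)) h +
         theta (permm R s) (permm R s') h + theta (permm R t) (permm R t') h) ^+ 2
    <= kappa * rnorm h ^+ 2.
Proof.
move=> s_inj t_inj s'_inj t'_inj kappa0 DE gap; set k := _ + _ + _.
have Ek : E k = k.
  rewrite /E /k !linearD !linear_sum /= -/(E _) -/(E _) !E_trep.
  by congr (_ + _ + _); apply: eq_bigr => i _; rewrite -/(E _) E_trep.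
apply: le_trans (ler_wpM2l kappa0 (bessel h)); rewrite parseval//.
have /= gap_h := gap (fun z => rnorm (e z h))
  (fun z => rnorm (e z (theta (permm R s) (permm R s') h)))
  (fun z => rnorm (e z (theta (permm R t) (permm R t') h))).
apply: le_trans (gap_h _ _); try by move=> z; rewrite perm_coord.
apply: ler_sum => z _; rewrite ler_pXn2r ?nnegrE ?rnorm_ge0//; last first.
  by rewrite !addr_ge0 ?mulr_ge0 ?rnorm_ge0.
rewrite /k /e !linearD /= -!/(e z _); apply: (le_trans (rnormD _ _)); rewrite lerD2r.
apply: (le_trans (rnormD _ _)); rewrite lerD2r.
rewrite -rnormZ_nat -DE natr_sum scaler_suml /e linear_sum -/(e z) /=.
suff -> : \sum_i theta (diagm R (pred1 z.1)) (diagm R (pred1 z.2))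
    (theta (diagm R (P i)) (diagm R (Q i)) h) =
  \sum_i (P i z.1 && Q i z.2)%:R *: e z h by [].
by apply: eq_bigr => i _; exact: e_diag.
Qed.

End MatrixTensorRep.

Lemma mact_continuous (R : realType) (I : finType) a : continuous (@mact R I a).
Proof.
apply: bounded_linear_continuous; apply/linear_boundedP.
exists (mnorm a)%:C; split; first by rewrite ger0_real// ler0c mnorm_ge0.
by move=> r /ltW ar x; rewrite (le_trans (mnormP _ _))// ler_wpM2r.
Qed.

Lemma cstar0 (R : realType) (A : cstarAlg R) : cstar (0 : A) = 0.
Proof. by have := cstarZ 0 (0 : A); rewrite rmorph0 !scale0r. Qed.

(** A representation of the tensor square of A (+) B restricts to the tensor
    product of the first summand with the second. *)
Section Corner.
Variables (R : realType) (A B : cstarAlg R) (L : hilbert R).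
Variable theta : tensor_rep (dsum A B) (dsum A B) L.
Local Notation S := (dsum A B).

Let op (a : A) (b : B) : {linear L -> L} := theta ((a, 0) : S) ((0, b) : S).

Let op_linearl b h : linear (fun a => op a b h).
Proof.
move=> z a a'; have := trep_linearl theta ((0, b) : S) h z ((a, 0) : S) ((a', 0) : S).
move=> /= <-; rewrite /op; congr (theta _ _ _).
by congr pair; rewrite /= scaler0 addr0.
Qed.

Let op_linearr a h : linear (fun b => op a b h).
Proof.
move=> z b b'; have := trep_linearr theta ((a, 0) : S) h z ((0, b) : S) ((0, b') : S).
move=> /= <-; rewrite /op; congr (theta _ _ _).
by congr pair; rewrite /= scaler0 addr0.
Qed.

Let opM a b a' b' h : op (cmul a a') (cmul b b') h = op a b (op a' b' h).
Proof.
rewrite /op -trepM; congr (theta _ _ _); rewrite /= /dsum_mul /=.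
  by rewrite linear0r.
by rewrite linear0r.
Qed.

Let op_adj a b h k : inner L (op a b h) k = inner L h (op (cstar a) (cstar b) k).
Proof. by rewrite /op trep_adj /= /dsum_star /= !cstar0. Qed.

Definition corner_rep : tensor_rep A B L :=
  @TensorRep R A B L op (fun a b => @trep_bounded _ _ _ _ theta _ _) op_linearl op_linearr
    opM op_adj.

End Corner.

(** * The spatial representation on l2(X x Y) *)

Section Spatial.
Variables (R : realType) (X Y : finType).
Local Notation C := (R[i]).
Local Notation MX := (matrix_alg R X).
Local Notation MY := (matrix_alg R Y).
Local Notation MXY := (matrix_alg R (X * Y)%type).
Local Notation S := (dsum MX MY).
Local Notation HX := (l2_hilbert R X).
Local Notation HY := (l2_hilbert R Y).
Local Notation L := (l2_hilbert R (X * Y)%type).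

Definition kron (a : MX) (b : MY) : MXY :=
  [ffun p => a (p.1.1, p.2.1) * b (p.1.2, p.2.2)].

Lemma kron_bilinear : bilinear_for *:%R *:%R kron.
Proof.
split=> [b z a a'|a z b b'] /=; apply/ffunP => p; rewrite !ffunE /GRing.scale /=.
- by rewrite mulrDl mulrA.
- by rewrite mulrDr mulrCA.
Qed.

Lemma kronM a a' b b' : kron (cmul a a') (cmul b b') = cmul (kron a b) (kron a' b').
Proof.
apply/ffunP => p; rewrite !ffunE /= big_distrlr /=.
rewrite (pair_bigA _ (fun x y => a (p.1.1, x) * a' (x, p.2.1) *
  (b (p.1.2, y) * b' (y, p.2.2)))) /=.
by apply: eq_bigr => -[x y] _ /=; rewrite !ffunE /= mulrACA.
Qed.

Lemma kron_star a b : kron (cstar a) (cstar b) = cstar (kron a b).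
Proof. by apply/ffunP => p; rewrite !ffunE /= rmorphM. Qed.

Let op (u w : S) : {linear L -> L} := mact (kron u.1 w.2).

Let op_linearl w h : linear (fun u => op u w h).
Proof. by move=> z u u'; rewrite /op /= (kron_bilinear.1 w.2 z) mact_linearl. Qed.

Let op_linearr u h : linear (fun w => op u w h).
Proof. by move=> z w w'; rewrite /op /= (kron_bilinear.2 u.1 z) mact_linearl. Qed.

Let opM u w u' w' h : op (cmul u u') (cmul w w') h = op u w (op u' w' h).
Proof. by rewrite /op /= kronM mactM. Qed.

Let op_adj u w h k : inner L (op u w h) k = inner L h (op (cstar u) (cstar w) k).
Proof. by rewrite /op /= kron_star; exact: mact_adj. Qed.

Definition kron_rep : tensor_rep S S L :=
  @TensorRep R S S L op (fun u w => @mact_continuous R _ _) op_linearl op_linearr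
    opM op_adj.

Definition tens (h : HX) (k : HY) : L := [ffun p => h p.1 * k p.2].

Lemma tens_bilinear : bilinear_for *:%R *:%R tens.
Proof.
split=> [b z a a'|a z b b'] /=; apply/ffunP => p; rewrite !ffunE /GRing.scale /=.
- by rewrite mulrDl mulrA.
- by rewrite mulrDr mulrCA.
Qed.

HB.instance Definition _ := bilinear_isBilinear.Build C HX HY L _ _ tens
  tens_bilinear.

Lemma tens_hilbert : is_hilbert_tensor (tens : {bilinear HX -> HY -> L}).
Proof.
split=> [h k h' k'|].
  rewrite /= /l2_inner big_distrlr /= (pair_bigA _ (fun x y =>
    h x * (h' x)^* * (k y * (k' y)^*))) /=.
  by apply: eq_bigr => -[x y] _ /=; rewrite !ffunE /= rmorphM mulrACA.
move=> U [x Ux] oU; exists x; split=> //.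
exists #|{: X * Y}|, (fun i => x (enum_val i) *: single _ (enum_val i).1),
  (fun i => single _ (enum_val i).2) => /=.
rewrite -(big_enum_val (fun p =>
  tens (x p *: single (l2 R X) p.1) (single (l2 R Y) p.2))).
rewrite [LHS](cspaceE (x : cspace (l2 R (X * Y)%type))); apply: eq_bigr => p _.
apply/ffunP => -[y z]; rewrite !ffunE /= /GRing.scale /= -mulrA -natrM mulnb.
by case: p.
Qed.

(** These two representations of the direct sum factor through one summand each,
    and so see only one component. *)
Definition left_rep : rep S HX.
Proof.
refine (@Rep R S HX (fun u => mact u.1) (fun u => @mact_continuous R _ _) _ _ _).
- by move=> h z u u'; exact: mact_linearl.
- by move=> u u' h; exact: mactM.
- by move=> u h k; exact: mact_adj.
Defined.

Definition right_rep : rep S HY.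
Proof.
refine (@Rep R S HY (fun u => mact u.2) (fun u => @mact_continuous R _ _) _ _ _).
- by move=> h z u u'; exact: mact_linearl.
- by move=> u u' h; exact: mactM.
- by move=> u h k; exact: mact_adj.
Defined.

Lemma kron_rep_spatial : is_spatial kron_rep.
Proof.
exists HX, HY, (tens : {bilinear HX -> HY -> L}), left_rep, right_rep.
split; first exact: tens_hilbert.
move=> u w h k; apply/ffunP => -[x y]; rewrite !ffunE /= big_distrlr /=.
rewrite (pair_bigA _ (fun x' y' => u.1 (x, x') * h x' * (w.2 (y, y') * k y'))) /=.
by apply: eq_bigr => -[x' y'] _ /=; rewrite !ffunE /= mulrACA.
Qed.

Lemma kron_rep_admissible alpha : admissible alpha kron_rep.
Proof. by case: alpha => //; exact: kron_rep_spatial. Qed.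

End Spatial.

(** * The separating tuples *)

Section Opnorm.
Variables (R : realType) (H : hilbert R) (X : H -> H) (c : R).
Hypothesis c0 : 0 <= c.
Hypothesis Xc : forall h, rnorm (X h) ^+ 2 <= c ^+ 2 * rnorm h ^+ 2.

Lemma unit_values_ub : ubound [set rnorm (X h) | h in @unit_ball R H] c.
Proof.
move=> _ [h /unit_ballE h1 <-]; rewrite -(@ler_pXn2r _ 2)// ?nnegrE ?rnorm_ge0//.
by rewrite (le_trans (Xc h))// ler_piMr ?sqr_ge0// expr_le1 ?rnorm_ge0.
Qed.

Lemma opnorm_le : opnorm X <= c.
Proof.
apply: ge_sup unit_values_ub; exists (rnorm (X 0)), 0 => //.
by rewrite /unit_ball /= normr0.
Qed.

Lemma opnorm_ge (h : H) (d : R) : h != 0 -> 0 <= d ->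
  (forall z : R[i], X (z *: h) = (d%:C * z) *: h) -> d <= opnorm X.
Proof.
move=> h0 d0 Xd; have h0' : 0 < `|h| by rewrite normr_gt0.
apply: sup_upper_bound.
  split; first by exists (rnorm (X 0)), 0 => //; rewrite /unit_ball /= normr0.
  by exists c; exact: unit_values_ub.
have u1 : `| `|h|^-1 *: h| = 1.
  by rewrite normrZ ger0_norm ?invr_ge0 ?(ltW h0')// mulVf// gt_eqF.
exists (`|h|^-1 *: h); first by rewrite /unit_ball /= u1.
apply: complexI; rewrite -rnormE Xd -scalerA normrZ u1 mulr1 ger0_norm//.
by rewrite ler0c.
Qed.

End Opnorm.

Section Witnesses.
Variable R : realType.
Local Notation M p := (matrix_alg R (torus p)).

(** Nine labels for the boxes and two for the shears. *)
Definition label : finType := ('I_3 * 'I_3 + bool)%type.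

Definition gen p (l : label) : M p :=
  match l with
  | inl b => diagm R (fun v => (v != origin p) && (box v == b))
  | inr true => permm R (@shear1 p)
  | inr false => permm R (@shear2 p)
  end.

(** A self-adjoint idempotent has norm 0 or 1 by the C*-identity. *)
Lemma norm_diagm (X : finType) (P : pred X) : `|diagm R P| <= 1.
Proof.
have := cnorm_cstar (diagm R P); rewrite diagm_star.
have -> : cmul (diagm R P) (diagm R P) = diagm R P.
  rewrite diagm_mulE; apply/ffunP => -[x y]; rewrite !ffunE /= -natrM mulnb.
  by rewrite andbCA andbb.
have [->|a0] := eqVneq (diagm R P) 0; first by rewrite normr0 ler01.
move=> /esym/eqP; rewrite expr2 -subr_eq0 -{3}[`|_|]mulr1 -mulrBr mulf_eq0.
by rewrite normr_eq0 (negbTE a0) /= subr_eq0 => /eqP ->.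
Qed.

Lemma norm_permm (X : finType) (s : X -> X) : injective s -> `|permm R s| <= 1.
Proof.
move=> s_inj; rewrite -(@expr_le1 _ 2)// -cnorm_cstar permm_star//.
exact: norm_diagm.
Qed.

Lemma norm_gen p l : `|gen p l| <= 1.
Proof.
case: l => [b|[]] /=; first exact: norm_diagm.
  exact: norm_permm (@shear1_inj p).
exact: norm_permm (@shear2_inj p).
Qed.

Local Notation n := #|{: label}|.

Definition left_tuple p (k : 'I_(n + n)) : M p :=
  match fintype.split k with inl i => gen p (enum_val i) | inr _ => 0 end.
Definition right_tuple p (k : 'I_(n + n)) : M p :=
  match fintype.split k with inl _ => 0 | inr i => gen p (enum_val i) end.

Lemma in_ball_left p : in_ball (@left_tuple p).
Proof.
move=> k; rewrite /unit_ball /= /left_tuple; case: fintype.split => i.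
  exact: norm_gen.
by rewrite normr0.
Qed.

Lemma in_ball_right p : in_ball (@right_tuple p).
Proof.
move=> k; rewrite /unit_ball /= /right_tuple; case: fintype.split => i.
  by rewrite normr0.
exact: norm_gen.
Qed.

Section Pair.
Variables (alpha : tensor_kind) (p q : nat).
Local Notation S := (dsum (M p) (M q)).

(** The norm of the sum of the [gen p l (x) gen q l], as a value of the T-function
    in the theorem: the tuple is a pair of tuples supported on the two summands. *)
Definition pair_norm : R :=
  tensor_fun alpha n S (pairv (@left_tuple p) (@right_tuple q)).

Definition gen_sum L (theta : tensor_rep (M p) (M q) L) (h : L) : L :=
  \sum_(l : label) theta (gen p l) (gen q l) h.

Lemma gen_sumE L (theta : tensor_rep (M p) (M q) L) h : gen_sum theta h =
  \sum_b theta (gen p (inl b)) (gen q (inl b)) h +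
  theta (permm R (@shear1 p)) (permm R (@shear1 q)) h +
  theta (permm R (@shear2 p)) (permm R (@shear2 q)) h.
Proof.
by rewrite /gen_sum big_sumType big_bool /= addrA.
Qed.

Lemma gen_sumZ L (theta : tensor_rep (M p) (M q) L) z h :
  gen_sum theta (z *: h) = z *: gen_sum theta h.
Proof. by rewrite [RHS]scaler_sumr; apply: eq_bigr => l _; rewrite linearZ. Qed.

Lemma pair_sumE L (theta : tensor_rep S S L) (h : L) :
  \sum_(k < n) theta (pairv (@left_tuple p) (@right_tuple q) (lshift n k))
    (pairv (@left_tuple p) (@right_tuple q) (rshift n k)) h =
  gen_sum (corner_rep theta) h.
Proof.
rewrite /gen_sum (big_enum_val (fun l => corner_rep theta (gen p l) (gen q l) h)).
apply: eq_bigr => k _; rewrite /pairv /left_tuple /right_tuple.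
by rewrite -[lshift n k]/(unsplit (inl k)) -[rshift n k]/(unsplit (inr k)) !unsplitK.
Qed.

Lemma gen_sum_bound L (theta : tensor_rep (M p) (M q) L) (kappa : R) (h : L) :
  0 <= kappa ->
  (forall f b c : torus p * torus q -> R,
     (forall z, b (shear1_pair z) = f z) -> (forall z, c (shear2_pair z) = f z) ->
     \sum_z ((same_box z)%:R * f z + b z + c z) ^+ 2 <= kappa * \sum_z f z ^+ 2) ->
  rnorm (gen_sum theta h) ^+ 2 <= kappa * rnorm h ^+ 2.
Proof.
move=> kappa0 gap; rewrite gen_sumE.
apply: (tensor_op_bound theta (D := @same_box p q)) gap => //; try
  by [exact: shear1_inj|exact: shear2_inj].
move=> [v w] /=; rewrite (bigD1 (box v))//= big1 => [|b bv].
  by rewrite eqxx andbT addn0 /same_box /= [box w == _]eq_sym andbA.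
by rewrite [box v == b]eq_sym (negbTE bv) andbF.
Qed.

Lemma pair_norm_set_neq0 : [set r | exists (L : hilbert R) (theta : tensor_rep S S L),
  admissible alpha theta /\
  r = opnorm (fun x : L => gen_sum (corner_rep theta) x)] !=set0.
Proof.
eexists; exists (l2_hilbert R (torus p * torus q)%type), (kron_rep R _ _).
by split; [exact: kron_rep_admissible|].
Qed.

Lemma pair_normE : pair_norm =
  sup [set r | exists (L : hilbert R) (theta : tensor_rep S S L),
    admissible alpha theta /\ r = opnorm (fun x : L => gen_sum (corner_rep theta) x)].
Proof.
rewrite /pair_norm /tensor_fun /tensor_norm; congr sup.
have E L (theta : tensor_rep S S L) : (fun x : L => \sum_(k < n)
    theta (pairv (@left_tuple p) (@right_tuple q) (lshift n k))
    (pairv (@left_tuple p) (@right_tuple q) (rshift n k)) x) =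
    (fun x : L => gen_sum (corner_rep theta) x).
  by apply/funext => x; exact: pair_sumE.
by apply/seteqP; split=> r [L [theta [ad ->]]]; exists L, theta; split=> //;
  rewrite E.
Qed.

Lemma gen_sum_bound9 L (theta : tensor_rep (M p) (M q) L) (h : L) :
  rnorm (gen_sum theta h) ^+ 2 <= 3 ^+ 2 * rnorm h ^+ 2.
Proof.
apply: gen_sum_bound => [|f b c]; first by rewrite sqr_ge0.
have -> : (3 : R) ^+ 2 = 9 by ring.
exact: three_term_bound (@shear1_pair_inj p q) (@shear2_pair_inj p q).
Qed.

(** The square of 3 - 1/100 exceeds 9 - 1/12. *)
Lemma pair_norm_coprime : coprime p.+1 q.+1 -> pair_norm <= 3 - 1 / 100.
Proof.
move=> co; rewrite pair_normE; apply: ge_sup; first exact: pair_norm_set_neq0.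
move=> _ [L [theta [_ ->]]]; apply: opnorm_le => [|h]; first by lra.
have k0 : 0 <= 9 - 1 / 12 :> R by lra.
apply: le_trans (gen_sum_bound (corner_rep theta) h k0 _) _ => [f b c|].
  exact: pair_gap.
by rewrite ler_wpM2r ?sqr_ge0//; lra.
Qed.

End Pair.

Section Diagonal.
Variable p : nat.
Hypothesis p0 : (0 < p)%N.
Local Notation X := (torus p).
Local Notation L := (l2_hilbert R (X * X)%type).
Local Notation theta := (corner_rep (kron_rep R X X)).

Lemma kron_diag_single (P Q : pred X) v w :
  theta (diagm R P) (diagm R Q) (single _ (v, w) : L) =
  (P v && Q w)%:R *: (single _ (v, w) : L).
Proof.
rewrite /= mact_single; apply/ffunP => -[x y]; rewrite !ffunE /= /GRing.scale /=.
rewrite -!natrM !mulnb xpair_eqE; congr (_ %:R).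
by have [->|] := eqVneq x v; have [->|] := eqVneq y w; rewrite /= ?andbT ?andbF.
Qed.

Lemma kron_perm_single (s : X -> X) v w :
  theta (permm R s) (permm R s) (single _ (v, w) : L) = (single _ (s v, s w) : L).
Proof.
rewrite /= mact_single; apply/ffunP => -[x y]; rewrite !ffunE /=.
by rewrite -natrM mulnb xpair_eqE.
Qed.

(** The vectorised identity matrix, without the origin. *)
Definition diagonal : L := \sum_(v | v != origin p) single _ (v, v).

Lemma diagonal_neq0 : diagonal != 0.
Proof.
pose v : X := (ord_max, ord_max).
have v0 : v != origin p.
  by rewrite xpair_eqE negb_and -val_eqE /= -lt0n p0.
apply/eqP => /(congr1 (fun h : {ffun X * X -> R[i]} => h (v, v))).
rewrite sum_ffunE (bigD1 v)//= big1 => [|w /andP[_ wv]].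
  by rewrite !ffunE eqxx addr0 => /eqP; rewrite oner_eq0.
by rewrite ffunE xpair_eqE [v == w]eq_sym (negbTE wv).
Qed.

Lemma diagonal_perm (s : X -> X) : injective s -> s (origin p) = origin p ->
  theta (permm R s) (permm R s) diagonal = diagonal.
Proof.
move=> s_inj s0; rewrite /diagonal linear_sum [RHS](reindex_inj s_inj) /=.
apply: eq_big => [v|v _]; first by rewrite -{2}s0 (inj_eq s_inj).
exact: kron_perm_single.
Qed.

Lemma gen_sum_diagonal : gen_sum theta diagonal = 3%:R *: diagonal.
Proof.
rewrite gen_sumE !diagonal_perm; try
  by [exact: shear1_inj|exact: shear2_inj|rewrite /shear1 /shear2 /= addr0].
suff -> : \sum_b theta (gen p (inl b)) (gen p (inl b)) diagonal = diagonal.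
  by rewrite [3%:R]mulrS [2%:R]mulrS !scalerDl !scale1r addrA.
rewrite /diagonal; under eq_bigr do rewrite linear_sum.
rewrite exchange_big /=; apply: eq_bigr => v v0.
rewrite (bigD1 (box v))//= big1 => [|b bv]; last first.
  by rewrite kron_diag_single [box v == b]eq_sym (negbTE bv) !andbF scale0r.
by rewrite kron_diag_single v0 eqxx scale1r addr0.
Qed.

Lemma pair_norm_diag alpha : 3 <= pair_norm alpha p p.
Proof.
have c0 : 0 <= 3 :> R by rewrite ler0n.
have bound (K : hilbert R) (t : tensor_rep _ _ K) :=
  @gen_sum_bound9 p p K (corner_rep t).
rewrite pair_normE; apply: (@le_trans _ _ (opnorm (fun x : L => gen_sum theta x))).
  apply: (opnorm_ge c0 (bound _ _) diagonal_neq0) => // z.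
  by rewrite gen_sumZ gen_sum_diagonal scalerA mulrC rmorph_nat.
apply: sup_upper_bound; last first.
  by exists L, (kron_rep R X X); split=> //; exact: kron_rep_admissible.
split; first exact: pair_norm_set_neq0.
by exists 3 => _ [K [t [_ ->]]]; exact: opnorm_le (bound _ _).
Qed.

End Diagonal.

End Witnesses.

Lemma pigeonhole_primes (K : finType) (c : nat -> K) : exists p q : nat,
  [/\ prime p, prime q, p != q & c p = c q].
Proof.
pose pr := fix pr k := if k is k'.+1 then s2val (prime_above (pr k')) else 2.
have pr_prime k : prime (pr k) by case: k => //= k; case: prime_above.
have pr_lt : {homo pr : i j / (i < j)%N}.
  by apply: homo_ltn => [? ? ?|k /=]; [exact: ltn_trans|case: prime_above].
have /injectivePn[i [j ij cij]] : ~~ injectiveb (fun i : 'I_#|K|.+1 => c (pr i)).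
  by apply/injectiveP => /leq_card; rewrite card_ord ltnn.
exists (pr i), (pr j); split=> //.
by case: (ltngtP i j) (ij) => [/pr_lt|/pr_lt|/val_inj ->]; rewrite ?eqxx//
  neq_ltn => ->; rewrite ?orbT.
Qed.

Theorem mainTheorem1 (R : realType) (alpha : tensor_kind) :
  ~ (forall n : nat, (1 <= n)%N ->
       realized (cstar_theory R) (tensor_fun alpha n)).
Proof.
move=> H; have n1 : (1 <= #|{: label}|)%N by apply/card_gt0P; exists (inr true).
(* Half of the gap 1/100. *)
have e0 : 0 < 1 / 200 :> R by lra.
have [K [c Hc]] := realized_colouring (H _ n1) e0.
have [p [q [p_prime q_prime pq cpq]]] :=
  pigeonhole_primes (fun p => c _ (@left_tuple R p.-1)).
(* The tori are indexed by the modulus minus one. *)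
have := Hc _ _ _ _ (@in_ball_left R p.-1) (@in_ball_left R q.-1) cpq
  _ _ (@in_ball_right R q.-1).
rewrite -!/(pair_norm R alpha _ _).
have coprime_pq : coprime p.-1.+1 q.-1.+1.
  by rewrite !prednK ?prime_gt0// prime_coprime// dvdn_prime2.
have q0 : (0 < q.-1)%N by have := prime_gt1 q_prime; case: (q).
have := pair_norm_coprime R alpha coprime_pq; have := pair_norm_diag R q0 alpha.
rewrite ler_norml => h1 h2 /andP[h3 h4]; lra.
Qed.
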